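(* Let $K$ be a field, let $S'=K[x_1,\dots,x_n]$ and $S=S'[x]=K[x_1,\dots,x_n,x]$ be polynomial rings, and let $I\subset S'$ be a squarefree monomial ideal all of whose squarefree powers $I^{[k]}$, $1\le k\le\nu(I)$, are componentwise linear. Let $J=(I,x)\subset S$. If $g_I$ is a non-increasing function, then $g_J$ is a non-increasing function.
   Context: All squarefree monomial ideals are nonzero and proper. For a squarefree monomial ideal $I$ in a polynomial ring $T$ over $K$, the $k$th squarefree power $I^{[k]}$ is the monomial ideal of $T$ generated by the squarefree monomials belonging to $I^k$. The monomial grade $\nu(I)$ is the biggest length of a monomial regular sequence contained in $I$; equivalently $I^{[k]}\neq(0)$ if and only if $k\le\nu(I)$. For $1\le k\le \nu(I)$, $d_k=\mathrm{indeg}(I^{[k]})$ is the minimum degree of a monomial generator of $I^{[k]}$, and the normalized depth function of $I$ is $g_I(k)=\mathrm{depth}(T/I^{[k]})-(d_k-1)$, a function on $\{1,\dots,\nu(I)\}$ (non-increasing refers to this domain). By convention the ambient polynomial ring $T$ is the smallest polynomial ring over $K$ containing the minimal monomial generators of $I$ (every variable divides some minimal generator); here $g_I$ is computed in $S'$ and $g_J$ in $S$. A homogeneous ideal $L$ is componentwise linear if for every $j$ the ideal generated by all homogeneous elements of degree $j$ in $L$ has a linear resolution. *)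

(* Defs.v *)
From Stdlib Require Export ClassicalEpsilon.
From HB Require Import structures.
From mathcomp Require Export all_boot all_order all_algebra.
From mathcomp.multinomials Require Export mpoly.

Set Implicit Arguments.
Unset Strict Implicit.
Unset Printing Implicit Defensive.

Import Order.TTheory GRing.Theory Num.Theory.

Local Open Scope ring_scope.

(* The value is unspecified when there is no maximum (resp. minimum). *)
Definition max_nat (P : nat -> Prop) : nat :=
  epsilon (inhabits 0%N) (fun d => P d /\ forall e, P e -> (e <= d)%N).

Definition min_nat (P : nat -> Prop) : nat :=
  epsilon (inhabits 0%N) (fun d => P d /\ forall e, P e -> (d <= e)%N).

(* Ideals are represented by their membership predicates. *)
Definition ideal_gen (R : comNzRingType) (A : R -> Prop) (f : R) : Prop :=
  exists (r : nat) (c s : 'I_r -> R),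
    (forall i, A (s i)) /\ f = \sum_(i < r) c i * s i.

Definition ideal_adjoin (R : comNzRingType) (L : R -> Prop) (s : seq R) :
    R -> Prop :=
  ideal_gen (fun f => L f \/ f \in s).

Definition ideal_pow (R : comNzRingType) (L : R -> Prop) (k : nat) :
    R -> Prop :=
  ideal_gen (fun f =>
    exists s : 'I_k -> R, (forall i, L (s i)) /\ f = \prod_(i < k) s i).

(* [s] is a regular sequence on the module R/L. *)
Definition regular_seq (R : comNzRingType) (L : R -> Prop) (s : seq R) :
    Prop :=
  (forall i, (i < size s)%N -> forall f,
     ideal_adjoin L (take i s) (s`_i * f) -> ideal_adjoin L (take i s) f)
  /\ ~ ideal_adjoin L s 1.

Definition irrelevant_ideal (K : fieldType) (n : nat) : {mpoly K[n]} -> Prop :=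
  ideal_gen (fun f => exists i : 'I_n, f = 'X_i).

(* depth(T/L) over T = K[x_1, ..., x_n]. *)
Definition depth (K : fieldType) (n : nat) (L : {mpoly K[n]} -> Prop) : nat :=
  max_nat (fun r => exists s : seq {mpoly K[n]},
    [/\ size s = r, forall f, f \in s -> irrelevant_ideal f
      & regular_seq L s]).

(* 0 is homogeneous of every degree, so [component L j] is generated by the
   whole degree-j part of L. *)
Definition component (K : fieldType) (n : nat) (L : {mpoly K[n]} -> Prop)
    (j : nat) : {mpoly K[n]} -> Prop :=
  ideal_gen (fun f => L f /\ f \is j.-homog).

(* An exact complex ... -> T(-d-1)^(b 1) -> T(-d)^(b 0) -> L -> 0.  Free
   modules consist of row vectors and the maps are right multiplications; since
   the generators have degree d, degree-preserving maps between these twists are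
   exactly matrices of linear forms.  Such a resolution is minimal, and the zero
   ideal has one (take b = 0). *)
Definition linear_resolution (K : fieldType) (n : nat)
    (L : {mpoly K[n]} -> Prop) (d : nat) (b : nat -> nat)
    (gens : 'cV[{mpoly K[n]}]_(b 0%N))
    (phi : forall i : nat, 'M[{mpoly K[n]}]_(b i.+1, b i)) : Prop :=
  [/\ (forall l, gens l ord0 \is d.-homog)
        /\ (forall i l m, phi i l m \is 1.-homog),
      forall f, L f <-> exists v : 'rV_(b 0%N), f = (v *m gens) ord0 ord0,
      forall v : 'rV_(b 0%N),
        v *m gens = 0 <-> exists w : 'rV_(b 1%N), v = w *m phi 0%N
    & forall (i : nat) (v : 'rV_(b i.+1)),
        v *m phi i = 0 <-> exists w : 'rV_(b i.+2), v = w *m phi i.+1].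

Definition has_linear_resolution (K : fieldType) (n : nat)
    (L : {mpoly K[n]} -> Prop) : Prop :=
  exists d b gens phi, @linear_resolution K n L d b gens phi.

Definition componentwise_linear (K : fieldType) (n : nat)
    (L : {mpoly K[n]} -> Prop) : Prop :=
  forall j, has_linear_resolution (component L j).

Definition squarefree_mnm (n : nat) (m : 'X_{1..n}) : Prop :=
  forall i : 'I_n, (m i <= 1)%N.

(* Squarefree monomial ideals are nonzero and proper by convention. *)
Definition squarefree_monomial_ideal (K : fieldType) (n : nat)
    (L : {mpoly K[n]} -> Prop) : Prop :=
  [/\ exists A : 'X_{1..n} -> Prop,
        (forall m, A m -> squarefree_mnm m) /\
        (forall f, L f <-> ideal_gen (fun g => exists2 m, A m & g = 'X_[m]) f),
      exists2 f, L f & f != 0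
    & ~ L 1].

(* On monomials [(m' <= m)%MM] is divisibility. *)
Definition minimal_generator (K : fieldType) (n : nat)
    (L : {mpoly K[n]} -> Prop) (m : 'X_{1..n}) : Prop :=
  L 'X_[m] /\ forall m', L 'X_[m'] -> (m' <= m)%MM -> m' = m.

Definition smallest_ambient (K : fieldType) (n : nat)
    (L : {mpoly K[n]} -> Prop) : Prop :=
  forall i : 'I_n, exists2 m, minimal_generator L m & (0 < m i)%N.

Definition squarefree_power (K : fieldType) (n : nat)
    (L : {mpoly K[n]} -> Prop) (k : nat) : {mpoly K[n]} -> Prop :=
  ideal_gen (fun f => exists m,
    [/\ squarefree_mnm m, f = 'X_[m] & ideal_pow L k 'X_[m]]).

Definition monomial_grade (K : fieldType) (n : nat)
    (L : {mpoly K[n]} -> Prop) : nat :=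
  max_nat (fun r => exists s : seq 'X_{1..n},
    [/\ size s = r, forall m, m \in s -> L 'X_[m]
      & regular_seq (fun f : {mpoly K[n]} => f = 0) [seq 'X_[m] | m <- s]]).

Definition indeg (K : fieldType) (n : nat) (L : {mpoly K[n]} -> Prop) : nat :=
  min_nat (fun d => exists2 m, minimal_generator L m & mdeg m = d).

Definition normalized_depth (K : fieldType) (n : nat)
    (L : {mpoly K[n]} -> Prop) (k : nat) : int :=
  (depth (squarefree_power L k))%:Z - ((indeg (squarefree_power L k))%:Z - 1).

Definition normalized_depth_nonincreasing (K : fieldType) (n : nat)
    (L : {mpoly K[n]} -> Prop) : Prop :=
  forall k l, (1 <= k)%N -> (k <= l)%N -> (l <= monomial_grade L)%N ->
    normalized_depth L l <= normalized_depth L k.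

(* The ideal (I, x) of K[x_1, ..., x_n, x], where x is the last variable. *)
Definition adjoin_variable (K : fieldType) (n : nat)
    (I : {mpoly K[n]} -> Prop) : {mpoly K[n.+1]} -> Prop :=
  ideal_gen (fun f => (exists2 p, I p & f = mwiden p) \/ f = 'X_ord_max).

(* Main.v *)
Require Import Defs.
From Stdlib Require Import FunctionalExtensionality PropExtensionality Classical.
From mathcomp Require Import ring zify.

(** Write S' = K[x_1, ..., x_n], S = S'[x], with I^[0] = S'.  As J^[k] is generated by squarefree
   monomials, J^[k] = I^[k] + x I^[k-1]: a polynomial belongs to it when its coefficient of x^0
   lies in I^[k] and its other coefficients lie in I^[k-1] (squarefree_power_adjoin).  Hence
   indeg J^[k] = indeg I^[k-1] + 1 (indeg_adjoin), and the monomial grade of J exceeds that of I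
   by at most one (monomial_grade_adjoin).

   Two inequalities hold for the depths.  First, depth S/J^[k+1] <= depth S'/I^[k] + 1
   (depth_adjoin_le), which reads g_J(k+1) <= g_I(k).  Second, depth S/J^[k] is at least
   min(depth S'/I^[k], depth S'/I^[k-1] + 1) (depth_adjoin_ge); as indeg I^[k-1] < indeg I^[k]
   and g_I(k) <= g_I(k-1), this gives g_I(k) <= g_J(k).  For k < l therefore
   g_J(l) <= g_I(l-1) <= g_I(k) <= g_J(k).

   Both depth inequalities concern a pair of ideals L <= L' of a noetherian ring R with an ideal m
   (here S' and its irrelevant ideal), and the ideal B of the polynomials in R[x] with
   coefficient of x^0 in L and other coefficients in L' (poly_pair).  A regular sequence on both
   R/L and R/L' is regular on R[x]/B, and the quotient of R[x]/B by it has the same shape; so one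
   reduces to the case in which R/L or R/L' has a nonzero socle, i.e. a nonzero element killed
   by m.  In that case everything is decided by the element x + f with f regular on R/L, which is
   regular on R[x]/B, and by explicit socle elements (depth_ge2_socle_free, socle_free_XDC).

   Such reductions need three facts on depth over a noetherian ring: ideals without socle have a
   common regular element of m (common_regular, by finiteness of the maximal associated primes
   and prime avoidance); dividing by a regular element lowers the depth by exactly one, whichever
   element is taken (depth_ge_adjoin1); and the length of regular sequences is bounded
   (depth_ge_bounded).  Polynomial rings over K are noetherian by Hilbert's basis theorem
   (noetherian_poly), and S is identified with S'[x] through muni. *)

Set Implicit Arguments.
Unset Strict Implicit.
Unset Printing Implicit Defensive.

Import Order.TTheory GRing.Theory Num.Theory.

Local Open Scope ring_scope.

(** * Ideals as predicates *)

(** Ideals with the same elements are identified, so that equal ideals can be rewritten. *)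
Lemma pred_ext (T : Type) (P Q : T -> Prop) : (forall x, P x <-> Q x) -> P = Q.
Proof.
by move=> PQ; apply: functional_extensionality => x; apply: propositional_extensionality.
Qed.

(** Dependent choice, for sequences whose next term is chosen in view of all the previous ones. *)
Lemma history_choice (T : Type) (good : seq T -> T -> Prop) :
  (forall s, exists x, good s x) ->
  exists f : nat -> T, forall k, good (mkseq f k) (f k).
Proof.
move=> ex_good.
pose step s := proj1_sig (constructive_indefinite_description _ (ex_good s)).
have stepP s : good s (step s).
  exact: (proj2_sig (constructive_indefinite_description _ (ex_good s))).
pose hist k := iter k (fun s => rcons s (step s)) [::].
exists (step \o hist) => k; suff -> : mkseq (step \o hist) k = hist k by [].
by elim: k => //= k IHk; rewrite mkseqS IHk.
Qed.

Lemma In_mem (T : eqType) (x : T) (s : seq T) : List.In x s <-> x \in s.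
Proof.
elim: s => //= y s IHs; rewrite in_cons; split=> [[->|/IHs ->]|/predU1P[->|/IHs]];
  by rewrite ?eqxx ?orbT; auto.
Qed.

Section Ideals.
Variable R : comNzRingType.
Implicit Types (L m P : R -> Prop) (f g h u z : R).

Definition is_ideal L :=
  [/\ L 0, forall f g, L f -> L g -> L (f + g) & forall a f, L f -> L (a * f)].

Definition adjoin1 L f : R -> Prop := fun g => exists a, L (g - a * f).

Definition colon L z : R -> Prop := fun f => L (f * z).

Definition regular L f := forall u, L (f * u) -> L u.

(** The socle of R/L with respect to m is zero. *)
Definition socle_free m L := forall z, (forall f, m f -> L (f * z)) -> L z.

Definition prime_ideal P :=
  [/\ is_ideal P, ~ P 1 & forall f g, P (f * g) -> P f \/ P g].

Section IdealLemmas.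
Variables (L : R -> Prop) (idL : is_ideal L).

Lemma ideal0 : L 0. Proof. by case: idL. Qed.

Lemma idealD f g : L f -> L g -> L (f + g). Proof. by case: idL => _ + _; apply. Qed.

Lemma idealMl a f : L f -> L (a * f). Proof. by case: idL => _ _; apply. Qed.

Lemma idealMr a f : L f -> L (f * a). Proof. by rewrite mulrC; apply: idealMl. Qed.

Lemma idealN f : L f -> L (- f). Proof. by rewrite -mulN1r; apply: idealMl. Qed.

Lemma idealB f g : L f -> L g -> L (f - g).
Proof. by move=> Lf Lg; apply: idealD => //; apply: idealN. Qed.

Lemma ideal_sum (J : Type) (r : seq J) (Q : pred J) (F : J -> R) :
  (forall j, Q j -> L (F j)) -> L (\sum_(j <- r | Q j) F j).
Proof. by move=> LF; elim/big_ind: _ => //; [apply: ideal0 | apply: idealD]. Qed.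

Lemma adjoin1_ideal f : is_ideal (adjoin1 L f).
Proof.
split=> [|g h [a La] [b Lb]|a g [b Lb]].
- by exists 0; rewrite mul0r subr0; apply: ideal0.
- exists (a + b); have -> : g + h - (a + b) * f = (g - a * f) + (h - b * f) by ring.
  exact: idealD.
- exists (a * b); have -> : a * g - a * b * f = a * (g - b * f) by ring.
  exact: idealMl.
Qed.

Lemma sub_adjoin1 f g : L g -> adjoin1 L f g.
Proof. by exists 0; rewrite mul0r subr0. Qed.

Lemma mem_adjoin1 f : adjoin1 L f f.
Proof. by exists 1; rewrite mul1r subrr; apply: ideal0. Qed.

Lemma adjoin1_min f (L' : R -> Prop) : is_ideal L' ->
  (forall g, L g -> L' g) -> L' f -> forall g, adjoin1 L f g -> L' g.
Proof.
move=> [_ L'D L'M] LL' L'f g [a Lg]; rewrite -(subrK (a * f) g).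
by apply: L'D; [apply: LL' | apply: L'M].
Qed.

Lemma colon_ideal z : is_ideal (colon L z).
Proof.
split=> [|f g|a f]; rewrite /colon; first by rewrite mul0r; apply: ideal0.
  by rewrite mulrDl; apply: idealD.
by rewrite -mulrA; apply: idealMl.
Qed.

End IdealLemmas.

Lemma adjoin1AC L f g : adjoin1 (adjoin1 L f) g = adjoin1 (adjoin1 L g) f.
Proof. by apply: pred_ext => h; split=> -[a [b Lab]]; exists b, a; rewrite addrAC. Qed.

(** * Noetherian rings *)

Definition span (f : nat -> R) (k : nat) g :=
  exists c : nat -> R, g = \sum_(i < k) c i * f i.

(** The ascending chain condition, tested on the chain of ideals spanned by initial segments. *)
Definition noetherian := forall f : nat -> R, exists k, span f k (f k).

Lemma chain_leq (A : nat -> R -> Prop) : (forall k f, A k f -> A k.+1 f) ->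
  forall i k f, (i <= k)%N -> A i f -> A k f.
Proof.
move=> subA i k f /subnK <-; elim: (k - i)%N => //= j IHj Ai.
by rewrite addSn; apply/subA/IHj.
Qed.

Hypothesis noethR : noetherian.

Lemma ascending_chain (A : nat -> R -> Prop) : (forall k, is_ideal (A k)) ->
  (forall k f, A k f -> A k.+1 f) -> exists k, forall f, A k.+1 f -> A k f.
Proof.
move=> idA subA; apply: NNPP => no_k.
have /(choice _) [f fP] k : exists f, A k.+1 f /\ ~ A k f.
  apply: NNPP => no_f; apply: no_k; exists k => f Af; apply: NNPP => nAf.
  by apply: no_f; exists f.
have [k [c fk]] := noethR f; case: (fP k) => _; apply; rewrite fk.
apply: (ideal_sum (idA k)) => i _; apply: (idealMl (idA k)).
exact: chain_leq subA _ _ _ (ltn_ord i) (proj1 (fP i)).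
Qed.

Lemma maximal_ideal_exists (Q : (R -> Prop) -> Prop) A0 :
    (forall A, Q A -> is_ideal A) -> Q A0 ->
  exists A, [/\ Q A, forall f, A0 f -> A f
    & forall B, Q B -> (forall f, A f -> B f) -> forall f, B f -> A f].
Proof.
move=> idQ QA0; apply: NNPP => no_max.
pose T := {A | Q A /\ forall f, A0 f -> A f}.
have ex_bigger (A : T) : exists B : T,
    (forall f, sval A f -> sval B f) /\ ~ (forall f, sval B f -> sval A f).
  case: A => A [QA subA] /=; apply: NNPP => no_B; apply: no_max; exists A.
  split=> // B QB AB; apply: NNPP => nBA; apply: no_B.
  by exists (exist _ B (conj QB (fun f Af => AB f (subA f Af)))).
have [next nextP] := choice _ ex_bigger.
pose A k := iter k next (exist _ A0 (conj QA0 (fun f => id))).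
have [||k subk] := @ascending_chain (fun k => sval (A k)).
- by move=> k; apply: idQ; case: (A k) => ? [].
- by move=> k; case: (nextP (A k)).
- by case: (nextP (A k)) => _; apply.
Qed.

(** ** Associated primes and prime avoidance *)

(** Maximality is among all the annihilators of nonzero elements of R/L. *)
Definition maximal_colon L z := ~ L z /\
  forall w, ~ L w -> (forall f, colon L z f -> colon L w f) ->
  forall f, colon L w f -> colon L z f.

Lemma maximal_colon_exists L u : is_ideal L -> ~ L u ->
  exists z, maximal_colon L z /\ forall f, colon L u f -> colon L z f.
Proof.
move=> idL nLu.
have [||_ [[z nLz ->] subz maxz]] :=
    @maximal_ideal_exists (fun A => exists2 z, ~ L z & A = colon L z) (colon L u).
- by move=> _ [z _ ->]; apply: colon_ideal.
- by exists u.
by exists z; split=> //; split=> // w nLw; apply: maxz; exists w.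
Qed.

(** If fg kills z and g does not, then f kills gz; but by maximality the annihilator of gz is no
   larger than that of z. *)
Lemma maximal_colon_prime L z : is_ideal L -> maximal_colon L z ->
  prime_ideal (colon L z).
Proof.
move=> idL [nLz maxz]; split; first exact: colon_ideal.
  by rewrite /colon mul1r.
move=> f g; rewrite /colon -mulrA => Lfgz.
have [Lgz|nLgz] := classic (L (g * z)); [by right | left].
apply: (maxz (g * z)) => // h; rewrite /colon => Lhz.
by rewrite mulrCA; apply: idealMl.
Qed.

Lemma prime_prod P (k : nat) (p : 'I_k -> R) : prime_ideal P ->
  P (\prod_i p i) -> exists i, P (p i).
Proof.
move=> [_ nP1 primeP]; elim: k p => [|k IHk] p; first by rewrite big_ord0.
rewrite big_ord_recl => /primeP[Pp|/IHk[i Pi]]; first by exists ord0.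
by exists (lift ord0 i).
Qed.

(** Every zero divisor of R/L lies in a maximal annihilator, so it remains to see that finitely
   many of these suffice.  Otherwise there are z_0, z_1, ... with maximal annihilators and, for
   each k, a zero divisor that kills z_k and none of the previous ones.  Some z_k is a
   combination of the previous ones; then the prime ann(z_k) contains the intersection of the
   ann(z_i), i < k, hence one of them, and equals it by maximality: a contradiction. *)
Lemma zerodivisors_covered L : is_ideal L ->
  exists Ps : list (R -> Prop),
    (forall P, List.In P Ps ->
       prime_ideal P /\ exists2 z, ~ L z & P = colon L z) /\
    (forall f, (forall P, List.In P Ps -> ~ P f) -> regular L f).
Proof.
move=> idL; apply: NNPP => no_cover.
pose good (s : seq R) z := (forall w, w \in s -> maximal_colon L w) ->
  maximal_colon L z /\
  exists f, L (f * z) /\ (forall w, w \in s -> ~ L (f * w)).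
have ex_good s : exists z, good s z.
  have [max_s|] := classic (forall w, w \in s -> maximal_colon L w); last by exists 0.
  apply: NNPP => no_z; apply: no_cover; exists [seq colon L w | w <- s].
  split=> [P /List.in_map_iff[w [<- /In_mem ws]]|f f_avoids u Lfu].
    split; first exact/maximal_colon_prime/max_s.
    by exists w => //; case: (max_s w ws).
  apply: NNPP => nLu; have [z [maxz subz]] := maximal_colon_exists idL nLu.
  apply: no_z; exists z => _; split=> //; exists f; split; first exact: subz.
  move=> w ws Lfw; apply: (f_avoids (colon L w)) => //.
  by apply/List.in_map_iff; exists w; split=> //; apply/In_mem.
have [z zP] := history_choice ex_good.
have z_max k : maximal_colon L (z k).
  elim/ltn_ind: k => k IHk; apply: (proj1 (zP k _)) => w /mapP[i].
  by rewrite mem_iota => /andP[_ ltik] ->; apply: IHk.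
have [k [c zk]] := noethR z.
have [|_ [f [Lfz nLf]]] := zP k.
  by move=> w /mapP[i _ ->].
have [i sub_i] : exists i : 'I_k, forall g, colon L (z i) g -> colon L (z k) g.
  apply: NNPP => no_i.
  have /(choice _) [p pP] (i : 'I_k) : exists p, L (p * z i) /\ ~ L (p * z k).
    apply: NNPP => no_p; apply: no_i; exists i => g Lg; apply: NNPP => nLg.
    by apply: no_p; exists g.
  have [|i] := @prime_prod _ _ p (maximal_colon_prime idL (z_max k)).
    rewrite /colon {1}zk mulr_sumr; apply: ideal_sum => // i _.
    rewrite mulrCA; apply: idealMl => //; rewrite (bigD1 i) //= mulrAC.
    by apply: idealMr => //; case: (pP i).
  by case: (pP i).
apply: (nLf (z i)); first by apply: (map_f z); rewrite mem_iota ltn_ord.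
by apply: (proj2 (z_max i)) sub_i _ Lfz; case: (z_max k).
Qed.

(** Induction on the number of primes.  A prime contained in another one may be dropped.  Otherwise,
   if h avoids all primes but P, add to it an element of m that lies in the other primes and not in P. *)
Lemma prime_avoidance m (Ps : list (R -> Prop)) : is_ideal m ->
  (forall P, List.In P Ps -> prime_ideal P /\ exists2 f, m f & ~ P f) ->
  exists2 h, m h & forall P, List.In P Ps -> ~ P h.
Proof.
move=> idm; move: {2}(size Ps) (erefl (size Ps)) => k.
elim: k Ps => [|k IHk] [|P Ps] //= => [_ _|[szPs] allP].
  by exists 0 => //; apply: ideal0.
have [[Q [inQ subQ]]|no_sub] :=
    classic (exists Q, List.In Q Ps /\ forall f, Q f -> P f).
  have [Ps1 [Ps2 eqPs]] := List.in_split _ _ inQ.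
  have sub12 P' : List.In P' (P :: Ps1 ++ Ps2) -> P = P' \/ List.In P' Ps.
    move=> /= [|/List.in_app_iff]; first by left.
    by rewrite eqPs List.in_app_iff /=; tauto.
  have [||h mh hP] := IHk (P :: Ps1 ++ Ps2).
  - by move: szPs; rewrite eqPs /= !size_cat /= addnS.
  - by move=> P' /sub12; apply: allP.
  exists h => // P' inP'.
  have [->|neqQ] := classic (P' = Q).
    by move/subQ; apply: hP; left.
  apply: hP; case: inP' => [|]; first by left.
  by rewrite eqPs !List.in_app_iff /= => -[?|[/esym //|?]]; right;
    rewrite List.in_app_iff; tauto.
have [||h mh hP] := IHk Ps => //.
  by move=> P' inP'; apply: allP; right.
have [[idP nP1 primeP] [y my nPy]] := allP P (or_introl erefl).
have [Ph|nPh] := classic (P h); last first.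
  by exists h => // P' [<- //|/hP].
have [p [pPs nPp]] : exists p, (forall Q, List.In Q Ps -> Q p) /\ ~ P p.
  have : forall Q, List.In Q Ps -> is_ideal Q /\ exists q, Q q /\ ~ P q.
    move=> Q inQ; have [[idQ _ _] _] := allP Q (or_intror inQ); split=> //.
    apply: NNPP => no_q; apply: no_sub; exists Q; split=> // f Qf.
    by apply: NNPP => nPf; apply: no_q; exists f.
  elim: (Ps) => [|Q Qs IHQs] Qall; first by exists 1.
  have [|p [pQs nPp]] := IHQs; first by move=> Q' inQ'; apply: Qall; right.
  have [idQ [q [Qq nPq]]] := Qall Q (or_introl erefl).
  exists (p * q); split=> [Q' [<-|inQ']|/primeP[]] //; first exact: idealMl.
  by apply: idealMr (pQs _ inQ'); case: (Qall Q' (or_intror inQ')).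
exists (h + y * p).
  by apply: idealD => //; apply: idealMr.
move=> Q [<-|inQ] Qhyp.
  have /primeP[//|//] : P (y * p).
    have -> : y * p = (h + y * p) - h by ring.
    exact: idealB.
apply: (hP Q inQ); have -> : h = (h + y * p) - y * p by ring.
have [[idQ _ _] _] := allP Q (or_intror inQ).
by apply: idealB => //; apply: idealMl => //; apply: pPs.
Qed.

(** The maximal associated primes of all these quotients form a finite set, and none of them
   contains m, since it is the annihilator of a nonzero element and no such element is killed
   by m. *)
Lemma common_regular m (Ls : list (R -> Prop)) : is_ideal m ->
  (forall L, List.In L Ls -> is_ideal L /\ socle_free m L) ->
  exists2 h, m h & forall L, List.In L Ls -> regular L h.
Proof.
move=> idm allL.
have [Ps [allP coverP]] : exists Ps : list (R -> Prop),
    (forall P, List.In P Ps -> prime_ideal P /\ exists2 f, m f & ~ P f) /\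
    (forall f, (forall P, List.In P Ps -> ~ P f) ->
       forall L, List.In L Ls -> regular L f).
  elim: Ls allL => [|L Ls IHLs] allL; first by exists [::].
  have [|Ps [allP coverP]] := IHLs; first by move=> L' inL'; apply: allL; right.
  have [idL freeL] := allL L (or_introl erefl).
  have [Qs [allQ coverQ]] := zerodivisors_covered idL.
  exists (Qs ++ Ps); split=> [P /List.in_app_iff[inP|/allP //]|f f_avoids L'].
    have [primeP [z nLz eqP]] := allQ P inP; split; rewrite {}eqP // in primeP *.
    apply: NNPP => no_f; apply: nLz; apply: freeL => f mf.
    by apply: NNPP => nLfz; apply: no_f; exists f.
  move=> /= [<-|inL']; [apply: coverQ | apply: coverP => //] => P inP;
    by apply: f_avoids; apply/List.in_app_iff; tauto.
have [h mh hP] := prime_avoidance idm allP.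
by exists h => //; apply: coverP.
Qed.

(** * Depth *)

(** The depth of R/L in m is at least r: a regular sequence is consumed from its head. *)
Fixpoint depth_ge m (r : nat) L : Prop :=
  if r is r'.+1 then exists f, [/\ m f, regular L f & depth_ge m r' (adjoin1 L f)]
  else True.

Section Depth.
Variables (m : R -> Prop) (idm : is_ideal m).

Lemma depth_geS_socle_free r L : depth_ge m r.+1 L -> socle_free m L.
Proof. by move=> [f [mf regf _]] z mz; apply: regf; apply: mz. Qed.

Lemma depth_geW r L : depth_ge m r.+1 L -> depth_ge m r L.
Proof. by elim: r L => //= r IHr L [f [mf regf /IHr Df]]; exists f. Qed.

Lemma depth_ge_leq r s L : (r <= s)%N -> depth_ge m s L -> depth_ge m r L.
Proof. by move/subnK <-; elim: (s - r)%N => //= k IHk /depth_geW. Qed.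

Lemma depth_ge1 L : is_ideal L -> socle_free m L -> depth_ge m 1 L.
Proof.
move=> idL freeL; have [|h mh hP] := @common_regular m [:: L] idm.
  by move=> _ [<-|[]].
by exists h; split=> //; apply: hP; left.
Qed.

(** The socles of R/(L, f) and R/(L, g) are isomorphic, both being Ext^1(R/m, R/L): z corresponds to
   the w such that f z = g w modulo L. *)
Lemma socle_free_exchange L f g : is_ideal L -> m f -> m g ->
  regular L f -> regular L g ->
  socle_free m (adjoin1 L f) -> socle_free m (adjoin1 L g).
Proof.
move=> idL mf mg regf regg freef z socz; have [w Lw] := socz f mf.
have [|v Lv] := freef w.
  move=> y my; have [u Lu] := socz y my; exists u; apply: regg.
  have -> : g * (y * w - u * f) = f * (y * z - u * g) - y * (f * z - w * g) by ring.
  by apply: idealB => //; apply: idealMl.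
exists v; apply: regf.
have -> : f * (z - v * g) = (f * z - w * g) + g * (w - v * f) by ring.
by apply: idealD => //; apply: idealMl.
Qed.

Lemma regular_swap L g h : is_ideal L -> regular L g -> regular (adjoin1 L g) h ->
  regular (adjoin1 L h) g.
Proof.
move=> idL regg regh u [v Lv].
have [|w Lw] := regh v.
  exists u; have -> : h * v - u * g = - (g * u - v * h) by ring.
  exact: idealN.
exists w; apply: regg.
have -> : g * (u - w * h) = (g * u - v * h) + h * (v - w * g) by ring.
by apply: idealD => //; apply: idealMl.
Qed.

(** All regular elements of m are equally good first terms of a regular sequence.  If g is the first
   term of a given one, an element h regular modulo L, (L, f) and (L, g) can be exchanged with
   both f and g, and the induction hypothesis applies modulo (L, g) and modulo (L, h). *)
Lemma depth_ge_adjoin1 r L f : is_ideal L -> m f -> regular L f ->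
  depth_ge m r.+1 L -> depth_ge m r (adjoin1 L f).
Proof.
elim: r L f => // r IHr L f idL mf regf DL.
have [g [mg regg Dg]] := DL.
have freef : socle_free m (adjoin1 L f).
  exact: socle_free_exchange (depth_geS_socle_free Dg).
have [|h mh hP] := @common_regular m [:: L; adjoin1 L f; adjoin1 L g] idm.
  move=> _ [<-|[<-|[<-|[]]]]; split=> //; try exact: adjoin1_ideal.
    exact: depth_geS_socle_free DL.
  exact: depth_geS_socle_free Dg.
have regh : regular L h by apply: hP; left.
have reghf : regular (adjoin1 L f) h by apply: hP; right; left.
have reghg : regular (adjoin1 L g) h by apply: hP; right; right; left.
exists h; split=> //; rewrite adjoin1AC; apply: (IHr) => //.
- exact: adjoin1_ideal.
- exact: regular_swap.
exists g; split=> //; first exact: regular_swap.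
by rewrite adjoin1AC; apply: IHr => //; apply: adjoin1_ideal.
Qed.

(** Otherwise one could divide by regular elements for ever, which gives an ascending chain of ideals
   inside m; a regular element lying in the ideal already divided out would put 1 into m. *)
Lemma depth_ge_bounded L : is_ideal L -> (forall f, L f -> m f) -> ~ m 1 ->
  exists r, ~ depth_ge m r L.
Proof.
move=> idL Lm nm1; apply: NNPP => unbounded.
have DL r : depth_ge m r L by apply: NNPP => nDr; apply: unbounded; exists r.
pose quo (s : seq R) := foldl adjoin1 L s.
pose good s f := (forall r, depth_ge m r (quo s)) -> m f /\ regular (quo s) f.
have [s|f fP] := history_choice (good := good).
  have [Ds|] := classic (forall r, depth_ge m r (quo s)); last by exists 0.
  by have [f [mf regf _]] := Ds 1%N; exists f.
pose A k := quo (mkseq f k).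
have AS k : A k.+1 = adjoin1 (A k) (f k) by rewrite /A /quo mkseqS foldl_rcons.
have AP k : is_ideal (A k) /\ forall r, depth_ge m r (A k).
  elim: k => [//|k [idA DA]]; rewrite AS; split; first exact: adjoin1_ideal.
  have [mf regf] := fP k DA.
  by move=> r; apply: depth_ge_adjoin1.
have Am k g : A k g -> m g.
  elim: k g => [|k IHk] //; rewrite AS; apply: adjoin1_min => //.
  by case: (fP k); case: (AP k).
have [k [c fk]] := noethR f; have [idA DA] := AP k; have [mf regf] := fP k DA.
apply: nm1; apply: (Am k); apply: regf; rewrite mulr1 fk; apply: ideal_sum => // i _.
apply: idealMl => //; apply: (@chain_leq A _ i.+1 k) => //.
  by move=> j g Ag; rewrite AS; apply: sub_adjoin1.
by rewrite AS; apply: mem_adjoin1; case: (AP i).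
Qed.

Lemma depth_exact L : is_ideal L -> (forall f, L f -> m f) -> ~ m 1 ->
  exists d, forall r, depth_ge m r L <-> (r <= d)%N.
Proof.
move=> idL Lm nm1; have [r nDr] := depth_ge_bounded idL Lm nm1.
elim: r nDr => [[]//|r IHr nDr].
have [Dr|] := classic (depth_ge m r L); last exact: IHr.
exists r => s; split=> [Ds|/depth_ge_leq]; last exact.
by rewrite leqNgt; apply/negP => /depth_ge_leq/(_ Ds).
Qed.

End Depth.

End Ideals.

(** * Polynomial rings *)

Lemma least_nat (P : nat -> Prop) : (exists n, P n) ->
  exists n, P n /\ forall k, P k -> (n <= k)%N.
Proof.
move=> [n]; elim/ltn_ind: n => n IHn Pn.
have [[k [Pk lt_kn]]|no_k] := classic (exists k, P k /\ (k < n)%N); first exact: IHn Pk.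
exists n; split=> // k Pk; rewrite leqNgt; apply/negP => lt_kn.
by apply: no_k; exists k.
Qed.

Section Span.
Variables (R : comNzRingType) (f : nat -> R).

Lemma span_ideal k : is_ideal (span f k).
Proof.
split=> [|_ _ [c ->] [d ->]|a _ [c ->]].
- by exists (fun=> 0); rewrite big1 // => i _; rewrite mul0r.
- exists (fun i => c i + d i); rewrite -big_split /=.
  by apply: eq_bigr => i _; rewrite mulrDl.
- exists (fun i => a * c i); rewrite mulr_sumr.
  by apply: eq_bigr => i _; rewrite mulrA.
Qed.

Lemma span_mem i k : (i < k)%N -> span f k (f i).
Proof.
move=> ltik; exists (fun j => (j == i)%:R); rewrite (bigD1 (Ordinal ltik)) //= eqxx mul1r.
by rewrite big1 ?addr0 // => j /negbTE; rewrite -val_eqE /= => ->; rewrite mul0r.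
Qed.

Lemma span_min (L : R -> Prop) k : is_ideal L -> (forall i, (i < k)%N -> L (f i)) ->
  forall g, span f k g -> L g.
Proof.
move=> idL Lf _ [c ->]; apply: ideal_sum => // i _.
by apply: idealMl => //; apply: Lf.
Qed.

Lemma span_leq j k g : (j <= k)%N -> span f j g -> span f k g.
Proof.
move=> lejk; apply: span_min; first exact: span_ideal.
by move=> i ltij; apply/span_mem/leq_trans/lejk.
Qed.

End Span.

(** Hilbert's basis theorem.  Choose successively a polynomial of least size outside the ideal
   spanned by the previous ones.  As soon as a leading coefficient is a combination of the
   previous ones, subtracting the corresponding multiples of the previous polynomials gives a
   smaller candidate, against the choice. *)
Lemma noetherian_poly (R : comNzRingType) : noetherian R -> noetherian {poly R}.
Proof.
move=> noethR f; apply: NNPP => no_k.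
have nspanf k : ~ span f k (f k) by move=> fk; apply: no_k; exists k.
pose I p := exists k, span f k p.
have idI : is_ideal I.
  split=> [|p q [j pj] [k qk]|a p [k pk]].
  - by exists 0%N; apply: (ideal0 (span_ideal f 0)).
  - exists (maxn j k); apply: (idealD (span_ideal f _)).
      exact: span_leq (leq_maxl _ _) pj.
    exact: span_leq (leq_maxr _ _) qk.
  - by exists k; apply: idealMl pk; apply: span_ideal.
pose sp (s : seq {poly R}) := span (nth 0 s) (size s).
pose good (s : seq {poly R}) g := (forall p, p \in s -> I p) ->
  [/\ I g, ~ sp s g & forall h, I h -> ~ sp s h -> (size g <= size h)%N].
have [s|g gP] := history_choice (good := good).
  have [Is|] := classic (forall p, p \in s -> I p); last by exists 0.
  have [k sub_k] : exists k, forall g, sp s g -> span f k g.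
    suff [k sk] : exists k, forall p, p \in s -> span f k p.
      exists k; apply: span_min; first exact: span_ideal.
      by move=> i lti; apply/sk/mem_nth.
    elim: s Is => [|p s IHs] Is; first by exists 0%N.
    have [|k sk] := IHs; first by move=> q qs; apply: Is; rewrite in_cons qs orbT.
    have [j pj] := Is p (mem_head _ _); exists (maxn j k) => q.
    rewrite in_cons => /predU1P[->|/sk]; first exact: span_leq (leq_maxl _ _) pj.
    exact/span_leq/leq_maxr.
  have [|n [[g [Ig nsg <-]] min_g]] :=
      @least_nat (fun n => exists g, [/\ I g, ~ sp s g & size g = n]).
    exists (size (f k)), (f k); split=> //; first by exists k.+1; apply: span_mem.
    by move/sub_k; apply: nspanf.
  by exists g => _; split=> // h Ih nsh; apply: min_g; exists h.
have spE k h : sp (mkseq g k) h <-> span g k h.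
  rewrite /sp /span size_mkseq; split=> -[c ->]; exists c;
    by apply: eq_bigr => i _; rewrite nth_mkseq.
have Ig k : I (g k).
  elim/ltn_ind: k => k IHk; case: (gP k) => // p /mapP[i].
  by rewrite mem_iota => /andP[_ lti] ->; apply: IHk.
have {}gP k : ~ span g k (g k) /\
    forall h, I h -> ~ span g k h -> (size (g k) <= size h)%N.
  have [|_ /spE nsg min_g] := gP k; first by move=> p /mapP[i _ ->].
  by split=> // h Ih /spE; apply: min_g.
have [k [c ck]] := noethR (fun i => lead_coef (g i)).
have [nsg min_g] := gP k.
have le_size i : (i <= k)%N -> (size (g i) <= size (g k))%N.
  by move=> leik; apply: (proj2 (gP i)) => // /(span_leq leik).
have size_gt0 i : (0 < size (g i))%N.
  rewrite lt0n size_poly_eq0; apply/eqP => gi0; case: (gP i) => + _; apply.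
  by rewrite gi0; apply: (ideal0 (span_ideal g i)).
pose d i := (size (g k) - size (g i))%N.
pose q := \sum_(i < k) (c i)%:P * 'X^(d i) * g i.
have sq : span g k q by exists (fun i => (c i)%:P * 'X^(d i)).
suff: (size (g k - q)%R < size (g k))%N.
  rewrite ltnNge => /negP; apply; apply: min_g.
    apply: idealB => //; apply: (span_min idI) sq => i _; exact: Ig.
  move=> sgq; apply: nsg; rewrite -(subrK q (g k)).
  by apply: idealD => //; apply: span_ideal.
rewrite -(prednK (size_gt0 k)) ltnS; apply/leq_sizeP => j lej.
have coef_q : q`_j = \sum_(i < k) c i * (g i)`_(j - d i).
  rewrite coef_sum; apply: eq_bigr => i _; rewrite -mulrA coefCM coefXnM.
  have dj : (d i <= j)%N by have := size_gt0 i; rewrite /d; lia.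
  by rewrite ltnNge dj.
rewrite coefB coef_q; have [->|neq_j] := eqVneq j (size (g k)).-1.
  rewrite -lead_coefE ck; apply/eqP; rewrite subr_eq0; apply/eqP.
  apply: eq_bigr => i _; rewrite lead_coefE; congr (_ * _`_ _).
  have := le_size i (ltnW (ltn_ord i)); have := size_gt0 i; have := size_gt0 k.
  by rewrite /d; lia.
have {neq_j}lt_j : (size (g k) <= j)%N.
  by rewrite -(prednK (size_gt0 k)) ltn_neqAle eq_sym neq_j.
rewrite nth_default // big1 ?subr0 // => i _; rewrite nth_default ?mulr0 // /d.
rewrite leq_subRL ?subnK //; first exact/le_size/ltnW.
exact: leq_trans (leq_subr _ _) lt_j.
Qed.

Section PolyPair.
Variable R : comNzRingType.
Implicit Types (L m : R -> Prop) (p q : {poly R}).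

(** For L <= L', the ideal L + x L' of R[x]. *)
Definition poly_pair L L' : {poly R} -> Prop :=
  fun p => L p`_0 /\ forall j, L' p`_j.+1.

(** The ideal (m, x) of R[x]. *)
Definition poly_irrelevant m := poly_pair m (fun=> True).

Lemma poly_pair_ideal L L' : is_ideal L -> is_ideal L' -> (forall f, L f -> L' f) ->
  is_ideal (poly_pair L L').
Proof.
move=> idL idL' subL; split=> [|p q [p0 pS] [q0 qS]|a p [p0 pS]].
- by split=> [|j]; rewrite coef0; apply: ideal0.
- by split=> [|j]; rewrite coefD; apply: idealD.
have pj j : L' p`_j by case: j => //; apply: subL.
split=> [|j]; first by rewrite coefM big_ord1; apply: idealMl.
by rewrite coefM; apply: ideal_sum => // i _; apply: idealMl.
Qed.

Lemma poly_irrelevant_ideal m : is_ideal m -> is_ideal (poly_irrelevant m).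
Proof. by move=> idm; apply: poly_pair_ideal. Qed.

Lemma poly_XDC p : exists q c, p = 'X * q + c%:P /\ p`_0 = c.
Proof.
elim/poly_ind: p => [|q c _]; first by exists 0, 0; rewrite coef0 mulr0 addr0.
by exists q, c; rewrite mulrC coefD coefXM coefC add0r.
Qed.

Section Pair.
Variables (m L L' : R -> Prop).
Hypotheses (idm : is_ideal m) (idL : is_ideal L) (idL' : is_ideal L').
Hypothesis subL : forall f, L f -> L' f.

Let idB : is_ideal (poly_pair L L') := poly_pair_ideal idL idL' subL.

Lemma poly_pairC f : L f -> poly_pair L L' f%:P.
Proof. by move=> Lf; split=> [|j]; rewrite coefC //=; apply: ideal0. Qed.

Lemma poly_pairXM p : (forall j, L' p`_j) -> poly_pair L L' ('X * p).
Proof. by move=> L'p; split=> [|j]; rewrite coefXM //=; apply: ideal0. Qed.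

Lemma adjoin1_poly_pair f :
  adjoin1 (poly_pair L L') f%:P = poly_pair (adjoin1 L f) (adjoin1 L' f).
Proof.
apply: pred_ext => p; split=> [[a [a0 aS]]|[[a0 La0] /(choice _)[a La]]].
  by split=> [|j]; [exists a`_0 | exists a`_j.+1]; rewrite -coefMC -coefB.
pose b := \poly_(j < size p) (if j is i.+1 then a i else a0); exists b.
have b_out j : (size p <= j)%N -> (p - b * f%:P)`_j = 0.
  move=> lepj; rewrite coefB coefMC coef_poly ltnNge lepj mul0r subr0.
  exact: nth_default.
split=> [|j]; [have := @b_out 0%N | have := @b_out j.+1];
  case: leqP => [_ ->// | ltp _]; try exact: ideal0;
  by rewrite coefB coefMC coef_poly ltp.
Qed.

Lemma regular_polyC f : regular L f -> regular L' f -> regular (poly_pair L L') f%:P.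
Proof.
move=> regL regL' p [p0 pS]; split=> [|j]; [apply: regL | apply: regL'];
  by rewrite -coefCM.
Qed.

Lemma coef_XDC_mul f p j : (('X + f%:P) * p)`_j.+1 = p`_j + f * p`_j.+1.
Proof. by rewrite mulrDl coefD coefXM coefCM. Qed.

(** Downward induction from the degree of p. *)
Lemma poly_coef_descent f p : (forall j, L' (p`_j.+1 + f * p`_j.+2)) ->
  forall j, L' p`_j.+1.
Proof.
move=> L'p j; have [k] : exists k, (size p <= j.+1 + k)%N.
  by exists (size p); rewrite leq_addl.
elim: k j => [|k IHk] j lej.
  by rewrite nth_default; [apply: ideal0 | rewrite addn0 in lej].
rewrite -(addrK (f * p`_j.+2) p`_j.+1); apply: idealB => //; apply: idealMl => //.
by apply: IHk; rewrite addSnnS.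
Qed.

(** The constant coefficient of (x + f) p is f p_0, so p_0 lies in L.  The other ones, p_j + f p_(j+1),
   determine p_j modulo L' from p_(j+1), whatever f does on R/L'; they give p_j in L' for all j > 0,
   starting from the top. *)
Lemma regular_XDC f : regular L f -> regular (poly_pair L L') ('X + f%:P).
Proof.
move=> regf p [p0 pS]; have Lp0 : L p`_0.
  by apply: regf; move: p0; rewrite mulrDl coefD coefXM coefCM add0r.
split=> //; apply: (poly_coef_descent (f := f)) => j.
by rewrite -coef_XDC_mul.
Qed.

(** A socle element z of R/L would be the x-component of a Koszul cocycle on R[x]/B whose other
   components vanish; it is not a coboundary, since z has degree 0 in x and x b does not.  Modulo
   a regular g = x g' + c this cocycle becomes the socle element z g'. *)
Lemma depth_ge2_socle_free r :
  depth_ge (poly_irrelevant m) r.+2 (poly_pair L L') -> socle_free m L.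
Proof.
move=> [g [[mg _] regg /depth_geS_socle_free freeg]] z socz.
have [g' [c [eg g0]]] := poly_XDC g; rewrite g0 in mg.
have LzC d : m d -> poly_pair L L' (d * z)%:P by move/socz/poly_pairC.
have [y [my _]|a Ba] := freeg (z%:P * g').
  have [y' [d [ey y0]]] := poly_XDC y; rewrite y0 in my; exists (z%:P * y').
  have -> : y * (z%:P * g') - z%:P * y' * g = (d * z)%:P * g' - (c * z)%:P * y'.
    by rewrite ey eg !polyCM; ring.
  by apply: idealB => //; apply: idealMr => //; apply: LzC.
have [|Lz _] := regg (z%:P - 'X * a).
  have -> : g * (z%:P - 'X * a) = 'X * (z%:P * g' - a * g) + (c * z)%:P.
    by rewrite eg polyCM; ring.
  by apply: idealD => //; [apply: idealMl | apply: LzC].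
by move: Lz; rewrite coefB coefC coefXM subr0.
Qed.

(** If w is a socle element of R/L', then x w is one of R[x]/(B, x + f): x (x w) = (x + f) x w
   modulo B, because f w lies in L'; and x w is nonzero there because f is regular on R/L. *)
Lemma socle_free_XDC f : m f -> regular L f ->
  socle_free (poly_irrelevant m) (adjoin1 (poly_pair L L') ('X + f%:P)) ->
  socle_free m L'.
Proof.
move=> mf regf freeB w socw; have [y [my _]|a [B0 BS]] := freeB ('X * w%:P).
  have [y' [d [ey y0]]] := poly_XDC y; rewrite y0 in my; exists ('X * w%:P * y').
  have -> : y * ('X * w%:P) - 'X * w%:P * y' * ('X + f%:P) =
            'X * ((d * w)%:P - (f * w)%:P * y').
    by rewrite ey !polyCM; ring.
  apply: poly_pairXM => j; rewrite coefB coefC coefCM.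
  apply: idealB => //; last by apply: idealMr => //; apply: socw.
  by case: j => [|j] //=; [apply: socw | apply: ideal0].
have coefa j : ('X * w%:P - a * ('X + f%:P))`_j.+1 =
    (j == 0%N)%:R * w - (a`_j + f * a`_j.+1).
  by rewrite (mulrC a) coefB coef_XDC_mul coefXM coefC; case: j => [|j]; rewrite ?mul1r ?mul0r.
have La0 : L a`_0.
  apply: regf; move/(idealN idL): B0.
  by rewrite (mulrC a) coefB coefXM mulrDl coefD coefXM coefCM !add0r opprK.
have L'a : forall j, L' a`_j.+1.
  apply: (poly_coef_descent (f := f)) => j; move/(idealN idL'): (BS j.+1).
  by rewrite coefa mul0r sub0r opprK.
have := BS 0%N; rewrite coefa mul1r => Lw.
rewrite -(subrK (a`_0 + f * a`_1) w); apply: idealD => //.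
by apply: idealD => //; [apply: subL | apply: idealMl].
Qed.

End Pair.

Hypothesis noethR : noetherian R.

(** A common regular element of R/L and R/L' lowers r by one on both sides of the claim; for the last
   step, in which nothing is known on R/L', take x + f. *)
Lemma depth_ge_poly_pair m r L L' : is_ideal m -> is_ideal L -> is_ideal L' ->
  (forall f, L f -> L' f) -> depth_ge m r L -> depth_ge m r.-1 L' ->
  depth_ge (poly_irrelevant m) r (poly_pair L L').
Proof.
move=> idm; elim: r L L' => [|[|r] IHr] L L' idL idL' subL //.
  move=> [f [mf regf _]] _; exists ('X + f%:P); split=> //; last exact: regular_XDC.
  by split=> //; rewrite coefD coefX coefC add0r.
move=> DL DL'; have [|h mh hP] := @common_regular _ noethR m [:: L; L'] idm.
  by move=> _ [<-|[<-|[]]]; split=> //; [apply: depth_geS_socle_free DL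
    | apply: depth_geS_socle_free DL'].
have reghL : regular L h by apply: hP; left.
have reghL' : regular L' h by apply: hP; right; left.
exists h%:P; split; first by split=> //; rewrite coefC.
  exact: regular_polyC.
rewrite adjoin1_poly_pair //; apply: IHr; try exact: adjoin1_ideal.
- by move=> f [a La]; exists a; apply: subL.
- exact: depth_ge_adjoin1 DL.
case: r DL' {DL} => [//|r] DL'; exact: depth_ge_adjoin1 DL'.
Qed.

(** For r > 0 both R/L and R/L' have zero socle, so a common regular element can be divided out. *)
Lemma poly_pair_depth_ge m r L L' : is_ideal m -> is_ideal L -> is_ideal L' ->
  (forall f, L f -> L' f) ->
  depth_ge (poly_irrelevant m) r.+1 (poly_pair L L') -> depth_ge m r L'.
Proof.
move=> idm; elim: r L L' => [//|r IHr] L L' idL idL' subL DB.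
have idM := poly_irrelevant_ideal idm.
have noethP := noetherian_poly noethR.
have idB := poly_pair_ideal idL idL' subL.
have freeL : socle_free m L by apply: depth_ge2_socle_free DB.
have [f [mf regf _]] := depth_ge1 noethR idm idL freeL.
have freeL' : socle_free m L'.
  apply: (socle_free_XDC _ _ _ mf regf) => //; apply: depth_geS_socle_free.
  apply: (depth_ge_adjoin1 noethP idM) DB => //; last exact: regular_XDC.
  by split=> //; rewrite coefD coefX coefC add0r.
have [|h mh hP] := @common_regular _ noethR m [:: L; L'] idm.
  by move=> _ [<-|[<-|[]]].
have reghL : regular L h by apply: hP; left.
have reghL' : regular L' h by apply: hP; right; left.
exists h; split=> //; apply: (IHr (adjoin1 L h)); try exact: adjoin1_ideal.
  by move=> g [a La]; exists a; apply: subL.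
rewrite -adjoin1_poly_pair //; apply: (depth_ge_adjoin1 noethP idM) DB => //.
  by split=> //; rewrite coefC.
exact: regular_polyC.
Qed.

End PolyPair.

(** * Transport along ring isomorphisms *)

Section Transport.
Variables (S T : comNzRingType) (phi : {rmorphism S -> T}).
Hypothesis bij_phi : bijective phi.

Lemma noetherian_bij : noetherian T -> noetherian S.
Proof.
move=> noethT f; have [k [c fk]] := noethT (phi \o f).
have [psi phiK psiK] := bij_phi.
exists k, (psi \o c); apply: (can_inj phiK); rewrite rmorph_sum [LHS]fk.
by apply: eq_bigr => i _; rewrite rmorphM /= psiK.
Qed.

Lemma depth_ge_bij m r (L : T -> Prop) :
  depth_ge m r L <-> depth_ge (m \o phi) r (L \o phi).
Proof.
have [psi phiK psiK] := bij_phi.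
have regE (A : T -> Prop) f : regular A (phi f) <-> regular (A \o phi) f.
  split=> regf u; first by rewrite /= rmorphM; apply: regf.
  by move=> Au; rewrite -(psiK u); apply: regf; rewrite /= rmorphM psiK.
have adjE (A : T -> Prop) f : adjoin1 (A \o phi) f = adjoin1 A (phi f) \o phi.
  apply: pred_ext => g; split=> -[a Aa].
    by exists (phi a); rewrite -rmorphM -rmorphB.
  by exists (psi a); rewrite /= rmorphB rmorphM psiK.
elim: r L => [//|r IHr] L; split=> -[f [mf regf Df]].
  exists (psi f); rewrite -(psiK f) in mf regf Df; split=> //; first exact/regE.
  by rewrite adjE; apply/IHr.
by exists (phi f); split=> //; [apply/regE | apply/IHr; rewrite -adjE].
Qed.

End Transport.

(** * Depth as the length of a longest regular sequence *)

Lemma max_natP (P : nat -> Prop) b : (exists d, P d) -> (forall d, P d -> (d <= b)%N) ->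
  P (max_nat P) /\ forall d, P d -> (d <= max_nat P)%N.
Proof.
move=> [d Pd] leb.
apply: (epsilon_spec (inhabits 0%N) (fun d => P d /\ forall e, P e -> (e <= d)%N)).
have [|c [[e [Pe <-]] min_c]] := @least_nat (fun c => exists e, P e /\ b - e = c)%N.
  by exists (b - d)%N, d.
exists e; split=> // k Pk; have := leb k Pk; have := leb e Pe.
by have := min_c (b - k)%N (ex_intro _ k (conj Pk erefl)); lia.
Qed.

Section GeneratedIdeals.
Variable R : comNzRingType.
Implicit Types (A L m : R -> Prop) (f : R) (s : seq R).

Lemma ideal_gen_mem A f : A f -> ideal_gen A f.
Proof.
by move=> Af; exists 1%N, (fun=> 1), (fun=> f); rewrite big_ord1 mul1r.
Qed.

Lemma ideal_gen_min A L : is_ideal L -> (forall f, A f -> L f) ->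
  forall f, ideal_gen A f -> L f.
Proof.
move=> idL subA _ [r [c [s [As ->]]]]; apply: ideal_sum => // i _.
by apply: idealMl => //; apply: subA.
Qed.

Lemma ideal_gen_ideal A : is_ideal (ideal_gen A).
Proof.
split=> [|_ _ [r [c [s [As ->]]]] [r' [c' [s' [As' ->]]]]|a _ [r [c [s [As ->]]]]].
- by exists 0%N, (fun=> 0), (fun=> 0); split=> [[]//|]; rewrite big_ord0.
- exists (r + r')%N, (fun i => match split i with inl j => c j | inr j => c' j end).
  exists (fun i => match split i with inl j => s j | inr j => s' j end); split.
    by move=> i; case: split.
  rewrite big_split_ord; congr (_ + _); apply: eq_bigr => i _.
    by rewrite (unsplitK (inl _ i)).
  by rewrite (unsplitK (inr _ i)).
- exists r, (fun i => a * c i), s; split=> //; rewrite mulr_sumr.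
  by apply: eq_bigr => i _; rewrite mulrA.
Qed.

Lemma ideal_gen_sub A B : (forall f, A f -> ideal_gen B f) ->
  forall f, ideal_gen A f -> ideal_gen B f.
Proof. by apply: ideal_gen_min; apply: ideal_gen_ideal. Qed.

Lemma ideal_adjoin_nil L : is_ideal L -> ideal_adjoin L [::] = L.
Proof.
move=> idL; apply: pred_ext => f; split; last by move=> Lf; apply: ideal_gen_mem; left.
by apply: ideal_gen_min => // g [].
Qed.

Lemma ideal_adjoin_cons L f s : is_ideal L ->
  ideal_adjoin L (f :: s) = ideal_adjoin (adjoin1 L f) s.
Proof.
move=> idL; apply: pred_ext => g; split; apply: ideal_gen_sub => h.
  case=> [Lh|]; first by apply: ideal_gen_mem; left; apply: sub_adjoin1.
  rewrite in_cons => /predU1P[->|hs]; apply: ideal_gen_mem; last by right.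
  by left; apply: mem_adjoin1.
case=> [[a La]|hs]; last by apply: ideal_gen_mem; right; rewrite in_cons hs orbT.
rewrite -(subrK (a * f) h); apply: idealD; first exact: ideal_gen_ideal.
  by apply: ideal_gen_mem; left.
apply: idealMl; first exact: ideal_gen_ideal.
by apply: ideal_gen_mem; right; apply: mem_head.
Qed.

Lemma regular_seq_nil L : is_ideal L -> regular_seq L [::] <-> ~ L 1.
Proof.
by move=> idL; rewrite /regular_seq ideal_adjoin_nil //; split=> [[]|].
Qed.

Lemma regular_seq_cons L f s : is_ideal L ->
  regular_seq L (f :: s) <-> regular L f /\ regular_seq (adjoin1 L f) s.
Proof.
move=> idL; rewrite /regular_seq ideal_adjoin_cons //; split.
  move=> [regS n1]; split.
    by move=> u Lfu; have := regS 0%N isT u; rewrite /= ideal_adjoin_nil //; apply.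
  split=> // i lti g; have := regS i.+1 lti g.
  by rewrite /= ideal_adjoin_cons.
move=> [regf [regS n1]]; split=> // -[|i] lti g.
  by rewrite /= ideal_adjoin_nil //; apply: regf.
by rewrite /= ideal_adjoin_cons //; apply: regS.
Qed.

Lemma depth_ge_regular_seq m L r : is_ideal m -> ~ m 1 ->
    is_ideal L -> (forall f, L f -> m f) ->
  depth_ge m r L <->
  exists s, [/\ size s = r, forall f, f \in s -> m f & regular_seq L s].
Proof.
move=> idm nm1; elim: r L => [|r IHr] L idL subL.
  split=> // _; exists [::]; split=> //; apply/regular_seq_nil => //.
  by move/subL.
split=> [[f [mf regf /IHr]]|[[|f s] [//= [szs] ms /(regular_seq_cons _ _ idL)]]].
  case=> [||s [szs ms regS]]; first exact: adjoin1_ideal.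
    by apply: adjoin1_min.
  exists (f :: s); split; [by rewrite /= szs | | exact/regular_seq_cons].
  by move=> g; rewrite in_cons => /predU1P[->|/ms].
have mf : m f by apply: ms; apply: mem_head.
move=> [regf regS]; exists f; split=> //; apply/IHr; first exact: adjoin1_ideal.
  exact: adjoin1_min.
by exists s; split=> // g gs; apply: ms; rewrite in_cons gs orbT.
Qed.

Lemma depth_ge_full m r L : m 0 -> (forall f, L f) -> depth_ge m r L.
Proof.
move=> m0; elim: r L => // r IHr L Lall; exists 0; split=> //; apply: IHr => f.
by exists 0.
Qed.

End GeneratedIdeals.

(** * Polynomial rings over a field *)

Section Mext.
Variable n : nat.

(** Monomials of S are pairs of a monomial of S' and an exponent j of the last variable. *)
Definition mext (m : 'X_{1..n}) (j : nat) : 'X_{1..n.+1} :=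
  (mnmwiden m + U_(ord_max) *+ j)%MM.

Definition mres (m : 'X_{1..n.+1}) : 'X_{1..n} :=
  [multinom m (widen_ord (leqnSn n) i) | i < n].

Lemma mnm_ord_maxP (Q : 'I_n.+1 -> Prop) :
  Q ord_max -> (forall i : 'I_n, Q (widen_ord (leqnSn n) i)) -> forall i, Q i.
Proof.
move=> Qmax Qw i; have [lti|gei] := ltnP i n.
  by have -> : i = widen_ord (leqnSn n) (Ordinal lti) by apply: val_inj.
have -> // : i = ord_max; apply: val_inj => /=.
by apply/eqP; rewrite eqn_leq gei -ltnS ltn_ord.
Qed.

Lemma widen_neq_max (i : 'I_n) : (ord_max == widen_ord (leqnSn n) i) = false.
Proof. by rewrite -val_eqE /= gtn_eqF. Qed.

Lemma mext_max m j : mext m j ord_max = j.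
Proof. by rewrite mnmDE mnmwiden_ordmax mulmnE mnm1E eqxx mul1n. Qed.

Lemma mext_widen m j i : mext m j (widen_ord (leqnSn n) i) = m i.
Proof.
by rewrite mnmDE mnmwiden_widen mulmnE mnm1E widen_neq_max addn0.
Qed.

Lemma mres_mext m j : mres (mext m j) = m.
Proof. by apply/mnmP => i; rewrite mnmE mext_widen. Qed.

Lemma mext_mres m : mext (mres m) (m ord_max) = m.
Proof.
apply/mnmP; apply: mnm_ord_maxP => [|i]; first by rewrite mext_max.
by rewrite mext_widen mnmE.
Qed.

Lemma mresD m1 m2 : mres (m1 + m2) = (mres m1 + mres m2)%MM.
Proof. by apply/mnmP => i; rewrite !mnmE. Qed.

Lemma mres_sum (s : seq 'X_{1..n.+1}) :
  mres (\big[+%MM/0%MM]_(a <- s) a) = \big[+%MM/0%MM]_(a <- map mres s) a.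
Proof.
rewrite big_map; apply: big_morph; first exact: mresD.
by apply/mnmP => i; rewrite !mnmE.
Qed.

Lemma lem_mres m1 m2 : (m1 <= m2)%MM -> (mres m1 <= mres m2)%MM.
Proof. by move/mnm_lepP => le12; apply/mnm_lepP => i; rewrite !mnmE. Qed.

Lemma mdeg_mres m : mdeg m = (mdeg (mres m) + m ord_max)%N.
Proof.
rewrite !mdegE big_ord_recr /=; congr (_ + _)%N.
by apply: eq_bigr => i _; rewrite mnmE.
Qed.

End Mext.

Section MultivariatePolynomials.
Variable K : fieldType.

Section Muni.
Variable n : nat.

Lemma muniX (m : 'X_{1..n.+1}) :
  muni 'X_[K, m] = 'X_[mres m] *: 'X^(m ord_max) :> {poly {mpoly K[n]}}.
Proof. by rewrite muniE msuppX big_seq1 mcoeffX eqxx scale1r. Qed.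

Lemma coef_muni (p : {mpoly K[n.+1]}) j (m : 'X_{1..n}) :
  ((muni p)`_j)@_m = p@_(mext m j).
Proof.
rewrite muniE coef_sum raddf_sum [in RHS](mpolyE p) raddf_sum /=.
apply: eq_bigr => m' _; rewrite coefZ coefXn mulr_natr mcoeffMn !mcoeffZ !mcoeffX.
rewrite -mulrnAr -mulrnA mulnb.
congr (_ * (nat_of_bool _)%:R); apply/andP/eqP => [[/eqP <- /eqP ->]|->].
  exact/esym/mext_mres.
by rewrite -[X in X == m]/(mres (mext m j)) mres_mext mext_max.
Qed.

Lemma muni_mwiden (q : {mpoly K[n]}) : muni (mwiden q) = q%:P.
Proof.
rewrite [in LHS](mpolyE q) (raddf_sum (@mwiden n K)) (raddf_sum (@muni n K)).
rewrite [in RHS](mpolyE q) (raddf_sum (@polyC _)) /=.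
apply: eq_bigr => m _; rewrite mwidenZ muniZ mwidenX muniX.
have -> : mnmwiden m = mext m 0 by rewrite /mext mulm0n addm0.
by rewrite mres_mext mext_max expr0 alg_polyC -mul_polyC -polyCM mul_mpolyC.
Qed.

Lemma muni_bij : bijective (@muni n K).
Proof.
have mmultiK : cancel (@mmulti n K) (@muni n K).
  move=> p; rewrite -[RHS]coefK poly_def (raddf_sum (@muni n K)) /=; apply: eq_bigr => i _.
  rewrite muniM rmorphXn /= muni_mwiden muniX mul_polyC; congr (_ *: _ ^+ _).
  have -> : U_(ord_max)%MM = mext 0 1 :> 'X_{1..n.+1}.
    by rewrite /mext mulm1n mnmwiden0 add0m.
  by rewrite mres_mext mext_max mpolyX0 scale1r.
exists (@mmulti n K) => // p; apply/mpolyP => m.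
by rewrite -(mext_mres m) -!coef_muni mmultiK.
Qed.

End Muni.

Lemma noetherian_mpoly n : noetherian {mpoly K[n]}.
Proof.
elim: n => [f|n IHn]; last exact: noetherian_bij (muni_bij n) (noetherian_poly IHn).
have [f0|nz_f0] := eqVneq (f 0%N) 0.
  by exists 0%N, (fun=> 0); rewrite big_ord0.
exists 1%N, (fun=> f 1%N * ((f 0%N)@_0%MM)^-1%:MP); rewrite big_ord1.
rewrite {2}[f 0%N]nvar0_mpolyC -mulrA -mpolyCM mulVf ?mulr1 //.
by apply: contra_neq nz_f0 => f00; rewrite [f 0%N]nvar0_mpolyC f00 mpolyC0.
Qed.

Section Irrelevant.
Variable n : nat.

Lemma irrelevant_ideal_ideal : is_ideal (@irrelevant_ideal K n).
Proof. exact: ideal_gen_ideal. Qed.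

Lemma irrelevantP (f : {mpoly K[n]}) : irrelevant_ideal f <-> f@_0%MM = 0.
Proof.
split=> [|f0].
  apply: (@ideal_gen_min _ _ (fun g : {mpoly K[n]} => g@_0%MM = 0)).
    split=> [|g h g0 h0|a g g0]; first by rewrite raddf0.
      by rewrite mcoeffD g0 h0 addr0.
    by rewrite rmorphM /= g0 mulr0.
  by move=> _ [i ->]; rewrite mcoeffX mnm1_eq0.
rewrite (mpolyE f); rewrite big_seq; apply: ideal_sum => [|m].
  exact: irrelevant_ideal_ideal.
rewrite mcoeff_msupp => nz_fm; rewrite -mul_mpolyC.
apply: idealMl; first exact: irrelevant_ideal_ideal.
have [i nz_mi] : exists i, m i != 0%N.
  apply/existsP; apply: contraNT nz_fm; rewrite negb_exists => /forallP m0.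
  suff -> : m = 0%MM by rewrite f0.
  by apply/mnmP => i; rewrite mnm0E; apply/eqP; rewrite -[_ == _]negbK.
rewrite -(@submK _ U_(i) m) ?lep1mP // mpolyXD; apply: idealMl.
  exact: irrelevant_ideal_ideal.
by apply: ideal_gen_mem; exists i.
Qed.

Lemma irrelevant1 : ~ @irrelevant_ideal K n 1.
Proof. by move/irrelevantP/eqP; rewrite mcoeff1 eqxx oner_eq0. Qed.

Lemma depth_geE (L : {mpoly K[n]} -> Prop) r : is_ideal L ->
  (forall f, L f -> irrelevant_ideal f) ->
  depth_ge (@irrelevant_ideal K n) r L <-> (r <= depth L)%N.
Proof.
move=> idL subL; have idm := irrelevant_ideal_ideal.
have [d dP] := depth_exact (@noetherian_mpoly n) idm idL subL irrelevant1.
suff -> : depth L = d by apply: dP.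
have [||Dd max_d] := @max_natP (fun r => exists s : seq {mpoly K[n]},
    [/\ size s = r, forall f, f \in s -> irrelevant_ideal f & regular_seq L s]) d.
- by exists 0%N; apply/(depth_ge_regular_seq 0 idm irrelevant1 idL subL).
- by move=> e /(depth_ge_regular_seq e idm irrelevant1 idL subL)/dP.
apply/eqP; rewrite eqn_leq; apply/andP; split.
  exact/dP/(depth_ge_regular_seq _ idm irrelevant1 idL subL).
by apply/max_d/(depth_ge_regular_seq _ idm irrelevant1 idL subL)/dP.
Qed.

End Irrelevant.

Lemma poly_irrelevant_muni n :
  poly_irrelevant (@irrelevant_ideal K n) \o @muni n K = @irrelevant_ideal K n.+1.
Proof.
apply: pred_ext => f; rewrite irrelevantP.
have -> : 0%MM = mext 0 0 :> 'X_{1..n.+1} by rewrite /mext mulm0n mnmwiden0 addm0.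
by rewrite -coef_muni -irrelevantP; split=> [[]|].
Qed.

End MultivariatePolynomials.

(** * Monomial ideals *)

Lemma pairwise_mem (T : eqType) (r : rel T) (s : seq T) : (forall x y, r x y = r y x) -> pairwise r s ->
  forall x y, x \in s -> y \in s -> x != y -> r x y.
Proof.
move=> sym_r; elim: s => //= z s IHs /andP[/allP rz /IHs rs] x y.
rewrite !in_cons => /predU1P[->|xs] /predU1P[->|ys]; rewrite ?eqxx // => neq.
- exact: rz.
- by rewrite sym_r; apply: rz.
- exact: rs.
Qed.

Section MonomialIdeals.
Variables (K : fieldType) (n : nat).
Implicit Types (P : 'X_{1..n} -> Prop) (a b m : 'X_{1..n}) (s : seq 'X_{1..n}).

Definition upclosed P := forall a m, P a -> (a <= m)%MM -> P m.

Definition upclosure P m := exists2 a, P a & (a <= m)%MM.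

(** The ideal spanned, as a vector space, by the monomials with exponent in P. *)
Definition mon_ideal P : {mpoly K[n]} -> Prop := fun f => forall m, m \in msupp f -> P m.

Lemma upclosure_upclosed P : upclosed (upclosure P).
Proof. by move=> a m [b Pb leba] leam; exists b => //; apply: lepm_trans leba leam. Qed.

Lemma mon_idealX P m : mon_ideal P 'X_[m] <-> P m.
Proof.
split=> [|Pm m' /mem_msuppXP <- //]; by apply; apply/mem_msuppXP.
Qed.

Lemma mon_ideal_ideal P : upclosed P -> is_ideal (mon_ideal P).
Proof.
move=> upP; split=> [m|f g If Ig m /msuppD_le|f g Ig m /msuppM_le].
- by rewrite msupp0.
- by rewrite mem_cat => /orP[/If|/Ig].
by case/allpairsP=> -[m1 m2] /= [_ /Ig Pm2 ->]; apply: upP Pm2 (lem_addl _ _).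
Qed.

Lemma mon_ideal_gen P (A : {mpoly K[n]} -> Prop) :
  (forall a, P a -> ideal_gen A 'X_[a]) -> forall f, mon_ideal P f -> ideal_gen A f.
Proof.
move=> PA f If; rewrite (mpolyE f) big_seq; apply: ideal_sum => [|m /If Pm].
  exact: ideal_gen_ideal.
by rewrite -mul_mpolyC; apply: idealMl; [apply: ideal_gen_ideal | apply: PA].
Qed.

Lemma ideal_gen_lem (A : {mpoly K[n]} -> Prop) a m :
  ideal_gen A 'X_[a] -> (a <= m)%MM -> ideal_gen A 'X_[m].
Proof.
by move=> Aa /submK <-; rewrite mpolyXD; apply: idealMl => //; apply: ideal_gen_ideal.
Qed.

Lemma ideal_gen_mon P (A : {mpoly K[n]} -> Prop) :
  (forall f, A f <-> exists2 a, P a & f = 'X_[a]) ->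
  ideal_gen A = mon_ideal (upclosure P).
Proof.
move=> AP; apply: pred_ext => f; split.
  apply: ideal_gen_min => [|g /AP[a Pa ->]].
    exact/mon_ideal_ideal/upclosure_upclosed.
  by apply/mon_idealX; exists a => //; apply: lepm_refl.
apply: mon_ideal_gen => m [a Pa]; apply: ideal_gen_lem.
by apply: ideal_gen_mem; apply/AP; exists a.
Qed.

(** ** Powers and squarefree powers *)

(** Exponents of the monomials in the k-th power of mon_ideal P. *)
Definition power_exp P k m :=
  exists s, [/\ size s = k, forall a, a \in s -> P a
    & (\big[+%MM/0%MM]_(a <- s) a <= m)%MM].

Definition sqfree_power_exp P k m :=
  exists m0, [/\ squarefree_mnm m0, (m0 <= m)%MM & power_exp P k m0].

Lemma power_exp_upclosed P k : upclosed (power_exp P k).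
Proof.
by move=> a m [s [szs Ps les]] leam; exists s; split=> //; apply: lepm_trans les leam.
Qed.

Lemma sqfree_power_exp_upclosed P k : upclosed (sqfree_power_exp P k).
Proof.
by move=> a m [m0 [sqm0 lem0 Pm0]] leam; exists m0; split=> //; apply: lepm_trans lem0 leam.
Qed.

Lemma ideal_powX P k m : ideal_pow (mon_ideal P) k 'X_[m] <-> power_exp P k m.
Proof.
split=> [|[s [szs Ps les]]]; last first.
  apply: ideal_gen_lem les; apply: ideal_gen_mem.
  exists (fun i : 'I_k => 'X_[nth 0%MM s i]); split=> [i|].
    by apply/mon_idealX/Ps/mem_nth; rewrite szs.
  by rewrite (big_nth 0%MM) big_mkord szs mprodXE.
suff sub : forall f, ideal_pow (mon_ideal P) k f -> mon_ideal (power_exp P k) f.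
  by move/sub/mon_idealX.
apply: ideal_gen_min; first exact/mon_ideal_ideal/power_exp_upclosed.
move=> _ [f [If ->]] {}m.
elim: k f If m => [|k IHk] f If m.
  rewrite big_ord0 => _; exists [::]; split=> //.
  by rewrite big_nil; apply/mnm_lepP => i; rewrite mnm0E.
rewrite big_ord_recl => /msuppM_le/allpairsP[[m1 m2] /= [m1f m2f ->]].
have [|s [szs Ps les]] := IHk _ _ m2 m2f; first by move=> i; apply: If.
exists (m1 :: s); split; first by rewrite /= szs.
  by move=> a; rewrite in_cons => /predU1P[->|/Ps //]; apply: If m1f.
rewrite big_cons; apply/mnm_lepP => i; rewrite !mnmDE leq_add2l.
exact: (mnm_lepP les).
Qed.

Lemma squarefree_powerE P k :
  squarefree_power (mon_ideal P) k = mon_ideal (sqfree_power_exp P k).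
Proof.
rewrite /squarefree_power (@ideal_gen_mon (fun m => squarefree_mnm m /\ power_exp P k m)).
  by congr mon_ideal; apply: pred_ext => m; split=> [[a []]|[a []]]; exists a.
move=> f; split=> [[m [sqm -> /ideal_powX Pm]]|[m [sqm Pm] ->]]; exists m => //.
by split=> //; apply/ideal_powX.
Qed.

Lemma sqfree_power_exp0 P m : sqfree_power_exp P 0 m.
Proof.
exists 0%MM; split; [by move=> i; rewrite mnm0E | by apply/mnm_lepP => i; rewrite mnm0E |].
by exists [::]; split=> //; rewrite big_nil; apply: lepm_refl.
Qed.

Lemma big_mnm_rem s a : a \in s ->
  \big[+%MM/0%MM]_(b <- s) b = (a + \big[+%MM/0%MM]_(b <- rem a s) b)%MM.
Proof. by move=> sa; rewrite (perm_big _ (perm_to_rem sa)) big_cons. Qed.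

(** Leave out one of the factors of a product of k + 1 elements. *)
Lemma sqfree_power_exp_drop P k m : ~ P 0%MM -> sqfree_power_exp P k.+1 m ->
  exists2 m', sqfree_power_exp P k m' & (m' <= m)%MM /\ (mdeg m' < mdeg m)%N.
Proof.
move=> nP0 [m0 [sqm0 lem0 [[|a s] [//= [szs] Ps les]]]].
rewrite big_cons in les; have nz_a : a != 0%MM.
  by apply/eqP => a0; apply: nP0; rewrite -a0; apply: Ps; apply: mem_head.
have leam : (a <= m0)%MM by apply: lepm_trans les; apply: lem_addr.
exists (m0 - a)%MM; last first.
  split; first by apply: lepm_trans lem0; apply: lem_subr.
  have := mdegD (m0 - a) a; have := mdegD (m - m0) m0; rewrite !submK // => -> ->.
  by move: nz_a; rewrite -mdeg_eq0; lia.
exists (m0 - a)%MM; split; last 1 first.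
- exists s; split=> //; first by move=> b bs; apply: Ps; rewrite in_cons bs orbT.
  by apply/mnm_lepP => i; have := mnm_lepP les i; rewrite mnmDE mnmBE; lia.
- by move=> i; rewrite mnmBE; apply: leq_trans (sqm0 i); apply: leq_subr.
exact: lepm_refl.
Qed.

Lemma sqfree_power_exp_anti P k m : ~ P 0%MM ->
  sqfree_power_exp P k.+1 m -> sqfree_power_exp P k m.
Proof.
move=> nP0 /(sqfree_power_exp_drop nP0)[m' Pm' [lem' _]].
exact: sqfree_power_exp_upclosed Pm' lem'.
Qed.

(** A monomial of least degree is a minimal generator. *)
Lemma indegP (L : {mpoly K[n]} -> Prop) m : L 'X_[m] ->
  (exists2 m', L 'X_[m'] & mdeg m' = indeg L) /\
  (forall m', L 'X_[m'] -> (indeg L <= mdeg m')%N).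
Proof.
move=> Lm.
have [|d [[m1 Lm1 <-] min1]] := @least_nat (fun d => exists2 m, L 'X_[m] & mdeg m = d).
  by exists (mdeg m), m.
have le1 m' : L 'X_[m'] -> (mdeg m1 <= mdeg m')%N by move=> Lm'; apply: min1; exists m'.
have min_gen1 : minimal_generator L m1.
  split=> // m' Lm' le_m'; have /eqP : mdeg (m1 - m') = 0%N.
    by have := le1 m' Lm'; have := mdegD (m1 - m') m'; rewrite submK //; lia.
  by rewrite mdeg_eq0 => /eqP e; rewrite -(submK le_m') e add0m.
have [[m2 [Lm2 _] e] min2] :
    (exists2 m, minimal_generator L m & mdeg m = indeg L) /\
    forall e, (exists2 m, minimal_generator L m & mdeg m = e) -> (indeg L <= e)%N.
  apply: (epsilon_spec (inhabits 0%N) (fun d =>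
    (exists2 m, minimal_generator L m & mdeg m = d) /\
    forall e, (exists2 m, minimal_generator L m & mdeg m = e) -> (d <= e)%N)).
  exists (mdeg m1); split; first by exists m1.
  by move=> e [m' [Lm' _] <-]; apply: le1.
split; first by exists m2.
move=> m' /le1; apply: leq_trans; apply: min2; by exists m1.
Qed.

(** ** Regular sequences of monomials *)

Definition mnm_coprime a b := [forall i, (a i == 0%N) || (b i == 0%N)].

(** Regularity of a sequence of monomials, tested on monomials only. *)
Definition mnm_regular s := forall i, (i < size s)%N -> forall m,
  upclosure (fun a => a \in take i s) (nth 0 s i + m)%MM ->
  upclosure (fun a => a \in take i s) m.

Lemma mnm_coprimeP a b : reflect (forall i, a i = 0%N \/ b i = 0%N) (mnm_coprime a b).
Proof.
apply: (iffP forallP) => cop i; first by case/orP: (cop i) => /eqP; [left | right].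
by case: (cop i) => ->; rewrite eqxx ?orbT.
Qed.

Lemma mnm_regular_rcons s b : mnm_regular (rcons s b) <->
  mnm_regular s /\ forall m,
    upclosure (fun a => a \in s) (b + m)%MM -> upclosure (fun a => a \in s) m.
Proof.
have take_lt i : (i < size s)%N -> take i (rcons s b) = take i s.
  by move=> lti; rewrite -cats1 (takel_cat _ (ltnW lti)).
have take_eq : take (size s) (rcons s b) = s by rewrite -cats1 take_size_cat.
split=> [regs|[regs regb] i].
  split=> [i lti m|m].
    have lti' : (i < size (rcons s b))%N by rewrite size_rcons ltnS ltnW.
    by have := regs i lti' m; rewrite nth_rcons lti take_lt.
  have lts : (size s < size (rcons s b))%N by rewrite size_rcons.
  by have := regs _ lts m; rewrite nth_rcons ltnn eqxx take_eq.
rewrite size_rcons ltnS leq_eqVlt => /predU1P[->|lti] m.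
  by rewrite nth_rcons ltnn eqxx take_eq; apply: regb.
by rewrite nth_rcons lti take_lt //; apply: regs.
Qed.

Lemma mnm_regular_coprime s : 0%MM \notin s ->
  mnm_regular s <-> pairwise mnm_coprime s.
Proof.
elim/last_ind: s => [|s b IHs]; first by move=> _; split.
rewrite mem_rcons in_cons negb_or => /andP[nz_b nz_s].
rewrite mnm_regular_rcons pairwise_rcons (IHs nz_s).
split=> [[cops regb]|/andP[copb cops]]; last first.
  split=> // m [a sa leabm]; exists a => //; apply/mnm_lepP => i.
  have := mnm_lepP leabm i; rewrite mnmDE.
  by case: (mnm_coprimeP _ _ (allP copb a sa) i) => ->.
rewrite cops andbT; apply/allP => a sa.
(* a divides b * (a / gcd (a, b)), so some entry of s divides a / gcd (a, b);
   it is a itself, since the other entries are coprime to a *)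
have [|c sc leca] := regb (a - b)%MM.
  by exists a => //; apply/mnm_lepP => i; rewrite mnmDE mnmBE; lia.
have ca : c = a.
  apply: contraNeq (nz_s) => neq_ca; suff <- : c = 0%MM by [].
  have cop_ca : mnm_coprime c a.
    apply: (pairwise_mem _ cops sc sa neq_ca) => x y.
    by apply: eq_forallb => i; rewrite orbC.
  apply/mnmP => i; rewrite mnm0E; case: (mnm_coprimeP _ _ cop_ca i) => // ai.
  by have := mnm_lepP leca i; rewrite mnmBE ai; lia.
apply/mnm_coprimeP => i; have := mnm_lepP leca i; rewrite ca mnmBE; lia.
Qed.

Lemma adjoin_monomials s :
  ideal_adjoin (fun f : {mpoly K[n]} => f = 0) [seq 'X_[m] | m <- s] =
  mon_ideal (upclosure (fun a => a \in s)).
Proof.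
have id_mon := mon_ideal_ideal (@upclosure_upclosed (fun a => a \in s)).
apply: pred_ext => f; split.
  apply: ideal_gen_min => // g [->|/mapP[a sa ->]]; first exact: ideal0.
  by apply/mon_idealX; exists a => //; apply: lepm_refl.
apply: mon_ideal_gen => m [a sa]; apply: ideal_gen_lem.
by apply: ideal_gen_mem; right; apply/mapP; exists a.
Qed.

Lemma monomial_regular_seq s :
  regular_seq (fun f : {mpoly K[n]} => f = 0) [seq 'X_[m] | m <- s] <->
  0%MM \notin s /\ pairwise mnm_coprime s.
Proof.
have one : ~ ideal_adjoin (fun f : {mpoly K[n]} => f = 0) [seq 'X_[m] | m <- s] 1 <->
    0%MM \notin s.
  rewrite adjoin_monomials -mpolyX0 mon_idealX; split=> [no0|/negP no0 [a sa le0]].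
    by apply/negP => s0; apply: no0; exists 0%MM => //; apply: lepm_refl.
  apply: no0; suff <- : a = 0%MM by [].
  by apply/mnmP => i; have := mnm_lepP le0 i; rewrite mnm0E leqn0 => /eqP.
have reg : (forall i, (i < size [seq 'X_[m] | m <- s])%N -> forall f : {mpoly K[n]},
      ideal_adjoin (fun f => f = 0) (take i [seq 'X_[m] | m <- s])
        ([seq 'X_[m] | m <- s]`_i * f) ->
      ideal_adjoin (fun f => f = 0) (take i [seq 'X_[m] | m <- s]) f) <->
    mnm_regular s.
  split=> regs i; last rewrite size_map => lti f.
    move=> lti m; have := regs i _ 'X_[m]; rewrite size_map -map_take adjoin_monomials.
    by rewrite (nth_map 0%MM) // -mpolyXD !mon_idealX; apply.
  rewrite -map_take adjoin_monomials (nth_map 0%MM) // => If m fm.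
  apply: (regs i lti); apply: If.
  by rewrite mulrC (perm_mem (msuppMX _ _)); apply: map_f.
split=> [[/reg regs /one s0]|[s0 cops]].
  by split=> //; apply/mnm_regular_coprime.
by split; [apply/reg/mnm_regular_coprime | apply/one].
Qed.

End MonomialIdeals.

(** * Adjoining a variable *)

Section AdjoinVariable.
Variables (K : fieldType) (n : nat).
Implicit Types (P : 'X_{1..n} -> Prop).

Definition adjoin_exp P (m : 'X_{1..n.+1}) := P (mres m) \/ (0 < m ord_max)%N.

Lemma mres_mnmwiden (m : 'X_{1..n}) : mres (mnmwiden m) = m.
Proof. by apply/mnmP => i; rewrite mnmE mnmwiden_widen. Qed.

Lemma lem_mnmwiden (a : 'X_{1..n}) m : (mnmwiden a <= m)%MM = (a <= mres m)%MM.
Proof.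
apply/mnm_lepP/mnm_lepP => leam; last apply: mnm_ord_maxP.
- by move=> i; rewrite mnmE -(mnmwiden_widen a).
- by rewrite mnmwiden_ordmax.
by move=> i; have := leam i; rewrite mnmE mnmwiden_widen.
Qed.

Lemma adjoin_exp_upclosed P : upclosed P -> upclosed (adjoin_exp P).
Proof.
move=> upP a m [Pa|a_max] leam; [left | right].
  exact: upP Pa (lem_mres leam).
exact: leq_trans a_max (mnm_lepP leam _).
Qed.

Lemma adjoin_variableE P : upclosed P ->
  adjoin_variable (mon_ideal P) = mon_ideal (adjoin_exp P) :> ({mpoly K[n.+1]} -> Prop).
Proof.
move=> upP; apply: pred_ext => f; split.
  apply: ideal_gen_min => [|_ [[p Ip ->] m|->]].
  - exact/mon_ideal_ideal/adjoin_exp_upclosed.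
  - rewrite mcoeff_msupp -(mext_mres m) -coef_muni muni_mwiden coefC.
    case: (m ord_max) => [|j]; last by rewrite raddf0 eqxx.
    by rewrite -mcoeff_msupp => /Ip Pm; left; rewrite mres_mext.
  by apply/mon_idealX; right; rewrite mnm1E eqxx.
apply: mon_ideal_gen => m [Pm|m_max].
  apply: (@ideal_gen_lem _ _ _ (mnmwiden (mres m))); last by rewrite lem_mnmwiden lepm_refl.
  apply: ideal_gen_mem; left; exists 'X_[mres m]; first exact/mon_idealX.
  by rewrite mwidenX.
apply: (@ideal_gen_lem _ _ _ U_(ord_max)); last by rewrite lep1mP -lt0n.
by apply: ideal_gen_mem; right.
Qed.

(** The exponent form of J^[k+1] = I^[k+1] + x I^[k]: at most one factor of a squarefree product
   involves x. *)
Lemma sqfree_power_exp_adjoin P k m :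
  sqfree_power_exp (adjoin_exp P) k.+1 m <->
  sqfree_power_exp P k.+1 (mres m) \/
  (0 < m ord_max)%N /\ sqfree_power_exp P k (mres m).
Proof.
have mres_power j (s : seq 'X_{1..n.+1}) m0 : size s = j -> squarefree_mnm m0 ->
    (m0 <= m)%MM -> (\big[+%MM/0%MM]_(a <- s) a <= m0)%MM ->
    (forall a, a \in s -> P (mres a)) -> sqfree_power_exp P j (mres m).
  move=> szs sqm0 lem0 les Ps; exists (mres m0); split; last 1 first.
  - exists (map (@mres n) s); split; first by rewrite size_map.
      by move=> _ /mapP[a sa ->]; apply: Ps.
    by rewrite -mres_sum; apply: lem_mres.
  - by move=> i; rewrite mnmE; apply: sqm0.
  - exact: lem_mres.
have le_sum (s : seq 'X_{1..n.+1}) a i : a \in s ->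
    (a i <= (\big[+%MM/0%MM]_(b <- s) b) i)%N.
  by move=> sa; rewrite (big_mnm_rem sa) mnmDE leq_addr.
split=> [[m0 [sqm0 lem0 [s [szs Ps les]]]]|].
  have [/hasP[a sa a_max]|/hasPn no_max] := boolP (has (fun a : 'X_{1..n.+1} => 0 < a ord_max)%N s).
    right; split.
      apply: leq_trans a_max (leq_trans _ (mnm_lepP lem0 _)).
      exact: leq_trans (le_sum _ _ _ sa) (mnm_lepP les _).
    rewrite (big_mnm_rem sa) in les; apply: (mres_power _ (rem a s) m0) => //.
    - by rewrite size_rem // szs.
    - by apply: lepm_trans les; apply: lem_addl.
    move=> b sb; have := Ps b (mem_rem sb); case=> // b_max.
    have := leq_add a_max (leq_trans b_max (le_sum _ _ ord_max sb)).
    rewrite -mnmDE => /leq_trans/(_ (mnm_lepP les ord_max)).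
    by move/leq_trans/(_ (sqm0 ord_max)).
  left; apply: (mres_power _ s m0) => // a sa.
  by case: (Ps a sa) => // a_max; have := no_max a sa; rewrite a_max.
have sum_widen s : \big[+%MM/0%MM]_(a <- map (@mnmwiden n) s) a =
    mnmwiden (\big[+%MM/0%MM]_(a <- s) a) by rewrite big_map -mnmwiden_sum.
case=> [[m0 [sqm0 lem0 [s [szs Ps les]]]]|[m_max [m0 [sqm0 lem0 [s [szs Ps les]]]]]].
  exists (mnmwiden m0); split; last 1 first.
  - exists (map (@mnmwiden n) s); split; first by rewrite size_map.
      by move=> _ /mapP[a sa ->]; left; rewrite mres_mnmwiden; apply: Ps.
    by rewrite sum_widen lem_mnmwiden mres_mnmwiden.
  - apply: mnm_ord_maxP; first by rewrite mnmwiden_ordmax.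
    by move=> i; rewrite mnmwiden_widen; apply: sqm0.
  - by rewrite lem_mnmwiden.
exists (U_(ord_max) + mnmwiden m0)%MM; split; last 1 first.
- exists (U_(ord_max)%MM :: map (@mnmwiden n) s); split.
  + by rewrite /= size_map szs.
  + move=> _ /predU1P[->|/mapP[a sa ->]]; first by right; rewrite mnm1E eqxx.
    by left; rewrite mres_mnmwiden; apply: Ps.
  rewrite big_cons sum_widen; apply/mnm_lepP => i; rewrite !mnmDE leq_add2l.
  by apply/mnm_lepP: i; rewrite lem_mnmwiden mres_mnmwiden.
- apply: mnm_ord_maxP => [|i]; rewrite mnmDE mnm1E.
    by rewrite eqxx mnmwiden_ordmax.
  by rewrite widen_neq_max mnmwiden_widen; apply: sqm0.
apply/mnm_lepP; apply: mnm_ord_maxP => [|i]; rewrite mnmDE mnm1E.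
  by rewrite eqxx mnmwiden_ordmax.
rewrite widen_neq_max mnmwiden_widen.
by have := mnm_lepP lem0 i; rewrite mnmE.
Qed.

Lemma mon_ideal_muni (Q0 Q1 : 'X_{1..n} -> Prop) (Q : 'X_{1..n.+1} -> Prop) :
  (forall m, Q0 m -> Q1 m) ->
  (forall m, Q m <-> Q0 (mres m) \/ (0 < m ord_max)%N /\ Q1 (mres m)) ->
  mon_ideal Q = poly_pair (mon_ideal Q0) (mon_ideal Q1) \o @muni n K.
Proof.
move=> sub01 QE; apply: pred_ext => f; split=> [If|[I0 I1] m].
  split=> [|j] m; rewrite mcoeff_msupp coef_muni -mcoeff_msupp => /If /QE;
    rewrite mres_mext mext_max //; first by case=> // -[].
  by case=> [/sub01|[]].
rewrite mcoeff_msupp -(mext_mres m) -coef_muni -mcoeff_msupp mext_mres => fm.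
apply/QE; case: (m ord_max) fm => [/I0|j /I1]; [by left | by right].
Qed.

End AdjoinVariable.

(** * The monomial grade *)

Section MonomialGrade.
Variables (K : fieldType) (n : nat).
Implicit Types (P : 'X_{1..n} -> Prop) (a m : 'X_{1..n}) (s : seq 'X_{1..n}).

Lemma zero_ideal (R : comNzRingType) : is_ideal (fun f : R => f = 0).
Proof. by split=> [|f g -> ->|a f ->]; rewrite ?addr0 ?mulr0. Qed.

Lemma mon_ideal_irrelevant P : ~ P 0%MM ->
  forall f : {mpoly K[n]}, mon_ideal P f -> irrelevant_ideal f.
Proof.
move=> nP0 f If; apply/irrelevantP/eqP; rewrite mcoeff_eq0.
by apply/negP => /If.
Qed.

(** The length of a regular sequence of monomials is bounded by the depth of the zero ideal, so the
   maximum defining the monomial grade exists. *)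
Lemma monomial_gradeP P r : ~ P 0%MM -> (r <= monomial_grade (@mon_ideal K n P))%N <->
  exists s, [/\ size s = r, forall m, m \in s -> P m & pairwise (@mnm_coprime n) s].
Proof.
move=> nP0; pose Q r := exists s,
  [/\ size s = r, forall m, m \in s -> mon_ideal P 'X_[K, m]
    & regular_seq (fun f : {mpoly K[n]} => f = 0) [seq 'X_[m] | m <- s]].
have QE d : Q d <->
    exists s, [/\ size s = d, forall m, m \in s -> P m & pairwise (@mnm_coprime n) s].
  split=> -[s [szs Ps]].
    by case/monomial_regular_seq => _ cops; exists s; split=> // m /Ps/mon_idealX.
  move=> cops; exists s; split=> // [m /Ps/mon_idealX //|].
  by apply/monomial_regular_seq; split=> //; apply/negP => /Ps.
have [||Qnu max_nu] := @max_natP Q (depth (fun f : {mpoly K[n]} => f = 0)).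
- by exists 0%N; apply/QE; exists [::].
- move=> d [s [szs Ps regs]]; have id0 := zero_ideal {mpoly K[n]}.
  have sub0 (f : {mpoly K[n]}) : f = 0 -> irrelevant_ideal f.
    by move->; apply: ideal0; apply: irrelevant_ideal_ideal.
  apply/(depth_geE _ id0 sub0); have idm := irrelevant_ideal_ideal K n.
  apply/(depth_ge_regular_seq _ idm (@irrelevant1 K n) id0 sub0).
  exists [seq 'X_[m] | m <- s]; split=> //; first by rewrite size_map.
  by move=> _ /mapP[m sm ->]; apply/mon_ideal_irrelevant/Ps.
split=> [ler|/QE/max_nu //]; have /QE[s [szs Ps cops]] := Qnu.
exists (take r s); split.
- by rewrite size_takel // szs.
- by move=> m /mem_take; apply: Ps.
by move: cops; rewrite -{1}(cat_take_drop r s) pairwise_cat => /and3P[].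
Qed.

Definition mnm_radical a : 'X_{1..n} := [multinom minn (a i) 1 | i < n].

(** The radicals of pairwise coprime monomials have a squarefree product. *)
Lemma monomial_grade_sqfree P k : ~ P 0%MM -> (forall a, P a -> P (mnm_radical a)) ->
  (k <= monomial_grade (@mon_ideal K n P))%N -> exists m, sqfree_power_exp P k m.
Proof.
move=> nP0 radP /(monomial_gradeP _ nP0)[s [szs Ps cops]].
pose m := \big[+%MM/0%MM]_(a <- map (@mnm_radical) s) a.
exists m, m; split; [ | exact: lepm_refl | ]; last first.
  exists (map (@mnm_radical) s); split; [by rewrite size_map | | exact: lepm_refl].
  by move=> _ /mapP[a sa ->]; apply/radP/Ps.
move=> i; rewrite /m big_map mnm_sumE.
elim: s cops {szs Ps m} => [|a s IHs] /=; first by rewrite big_nil.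
case/andP=> /allP cop_a /IHs le_s; rewrite big_cons mnmE.
have [ai|nz_ai] := eqVneq (a i) 0%N; first by rewrite ai.
rewrite big_seq big1 ?addn0 ?geq_minr // => b /cop_a/mnm_coprimeP/(_ i)[ai|bi].
  by rewrite ai in nz_ai.
by rewrite mnmE bi.
Qed.

Lemma squarefree_monomial_idealE (I : {mpoly K[n]} -> Prop) :
  squarefree_monomial_ideal I ->
  exists P, [/\ upclosed P, ~ P 0%MM, forall a, P a -> P (mnm_radical a)
    & I = mon_ideal P].
Proof.
case=> [[A [sqA IE]] _ nI1]; exists (upclosure A).
have eI : I = mon_ideal (upclosure A).
  rewrite -(@ideal_gen_mon K n A (fun g => exists2 m, A m & g = 'X_[m])) //.
  exact: pred_ext.
split=> //; first exact: upclosure_upclosed.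
  by move=> P0; apply: nI1; rewrite eI -mpolyX0; apply/mon_idealX.
move=> m [a Aa leam]; exists a => //; apply/mnm_lepP => i.
by rewrite mnmE leq_min (mnm_lepP leam) sqA.
Qed.

End MonomialGrade.

(** At most one of the pairwise coprime monomials of a regular sequence in (I, x) involves x. *)
Lemma monomial_grade_adjoin (K : fieldType) n (P : 'X_{1..n} -> Prop) l : ~ P 0%MM ->
  (l.+1 <= monomial_grade (@mon_ideal K n.+1 (adjoin_exp P)))%N ->
  (l <= monomial_grade (@mon_ideal K n P))%N.
Proof.
move=> nP0; have nPJ0 : ~ adjoin_exp P 0%MM.
  case; last by rewrite mnm0E.
  suff -> : mres 0%MM = 0%MM :> 'X_{1..n} by [].
  by apply/mnmP => i; rewrite !mnmE.
case/(monomial_gradeP _ _ nPJ0) => s [szs Ps cops].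
pose no_max (a : 'X_{1..n.+1}) := a ord_max == 0%N.
have small : (size [seq a <- s | ~~ no_max a] <= 1)%N.
  have := pairwise_filter (fun a => ~~ no_max a) cops.
  have := filter_all (fun a => ~~ no_max a) s.
  case: filter => [|a [|b t]] //= /and3P[a_max b_max _] /andP[/andP[/mnm_coprimeP cop _] _].
  by rewrite /no_max in a_max b_max; case: (cop ord_max) => e; rewrite e in a_max b_max.
pose t := [seq mres a | a <- s & no_max a].
have le_lt : (l <= size t)%N.
  rewrite size_map size_filter -ltnS -szs -(count_predC no_max) -[leqRHS]addn1 leq_add2l.
  by rewrite -size_filter.
apply: leq_trans le_lt _; apply/(monomial_gradeP _ _ nP0); exists t; split=> //.
  move=> _ /mapP[a + ->]; rewrite mem_filter => /andP[/eqP a0 /Ps[//|]].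
  by rewrite a0.
have := pairwise_filter no_max cops; rewrite pairwise_map; apply: sub_pairwise.
move=> a b /mnm_coprimeP cop; apply/mnm_coprimeP => i; rewrite !mnmE.
exact: cop.
Qed.

(** * Depth and initial degree of the squarefree powers of (I, x) *)

Section AdjoinedPowers.
Variables (K : fieldType) (n : nat) (P : 'X_{1..n} -> Prop).
Hypotheses (upP : upclosed P) (nP0 : ~ P 0%MM).

Let I : {mpoly K[n]} -> Prop := mon_ideal P.
Let J : {mpoly K[n.+1]} -> Prop := mon_ideal (adjoin_exp P).

Lemma squarefree_power_adjoin k : squarefree_power J k.+1 =
  poly_pair (squarefree_power I k.+1) (squarefree_power I k) \o @muni n K.
Proof.
rewrite !squarefree_powerE; apply: mon_ideal_muni.
  by move=> m; apply: sqfree_power_exp_anti.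
by move=> m; apply: sqfree_power_exp_adjoin.
Qed.

Lemma squarefree_power_ideal k : is_ideal (squarefree_power I k).
Proof. exact: ideal_gen_ideal. Qed.

Lemma squarefree_power_anti k f : squarefree_power I k.+1 f -> squarefree_power I k f.
Proof.
by rewrite !squarefree_powerE => If m /If; apply: sqfree_power_exp_anti.
Qed.

Lemma squarefree_power_irrelevant k f :
  squarefree_power I k.+1 f -> irrelevant_ideal f.
Proof.
rewrite squarefree_powerE; apply: mon_ideal_irrelevant.
by case/(sqfree_power_exp_drop nP0) => m _ []; rewrite mdeg0.
Qed.

Lemma squarefree_power_adjoin_irrelevant k f :
  squarefree_power J k.+1 f -> irrelevant_ideal f.
Proof.
rewrite squarefree_power_adjoin -poly_irrelevant_muni => -[If _]; split=> //.
exact: squarefree_power_irrelevant If.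
Qed.

Lemma depth_adjoinE k r : (r <= depth (squarefree_power J k.+1))%N <->
  depth_ge (poly_irrelevant (@irrelevant_ideal K n)) r
    (poly_pair (squarefree_power I k.+1) (squarefree_power I k)).
Proof.
rewrite (depth_ge_bij (muni_bij K n)) poly_irrelevant_muni -squarefree_power_adjoin.
symmetry; apply: depth_geE; first exact: ideal_gen_ideal.
exact: squarefree_power_adjoin_irrelevant.
Qed.

Lemma depth_adjoin_le k :
  (depth (squarefree_power J k.+2) <= (depth (squarefree_power I k.+1)).+1)%N.
Proof.
case def_r: (depth _) => [|r] //; rewrite ltnS.
apply/depth_geE; [exact: squarefree_power_ideal | exact: squarefree_power_irrelevant |].
apply: (poly_pair_depth_ge (@noetherian_mpoly K n) (irrelevant_ideal_ideal K n)
  (squarefree_power_ideal k.+2)) => //; first exact: squarefree_power_ideal.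
  exact: squarefree_power_anti.
by apply/depth_adjoinE; rewrite def_r.
Qed.

(** For k = 0 the ideal I^[0] is the whole ring, on which there is no condition. *)
Lemma depth_adjoin_ge k r : (r <= depth (squarefree_power I k.+1))%N ->
  (k = 0%N \/ (r.-1 <= depth (squarefree_power I k))%N) ->
  (r <= depth (squarefree_power J k.+1))%N.
Proof.
move=> ler ler1; apply/depth_adjoinE.
apply: (depth_ge_poly_pair (@noetherian_mpoly K n) (irrelevant_ideal_ideal K n)).
- exact: squarefree_power_ideal.
- exact: squarefree_power_ideal.
- exact: squarefree_power_anti.
- by apply/depth_geE => //; [exact: squarefree_power_ideal
    | exact: squarefree_power_irrelevant].
case: k ler ler1 => [|k] ler ler1; last first.
  by case: ler1 => // ler1; apply/depth_geE => //; [exact: squarefree_power_ideal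
    | exact: squarefree_power_irrelevant].
apply: depth_ge_full; first exact: ideal0 (irrelevant_ideal_ideal K n).
by move=> f; rewrite squarefree_powerE => m _; apply: sqfree_power_exp0.
Qed.

Lemma squarefree_powerX k m : squarefree_power I k 'X_[m] <-> sqfree_power_exp P k m.
Proof. by rewrite squarefree_powerE mon_idealX. Qed.

Lemma indeg_squarefree_powerS k m : sqfree_power_exp P k.+1 m ->
  (indeg (squarefree_power I k) < indeg (squarefree_power I k.+1))%N.
Proof.
move=> /squarefree_powerX Im; have [[m1 /squarefree_powerX I1 <-] _] := indegP Im.
have [m' /squarefree_powerX Im' [_ lt_deg]] := sqfree_power_exp_drop nP0 I1.
have [_ /(_ _ Im')] := indegP Im'; move/leq_ltn_trans; exact.
Qed.

Lemma indeg_adjoin k m : sqfree_power_exp P k m ->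
  indeg (squarefree_power J k.+1) = (indeg (squarefree_power I k)).+1.
Proof.
move=> /squarefree_powerX Im; have [[m1 /squarefree_powerX I1 e1] min1] := indegP Im.
have JX m' : squarefree_power J k.+1 'X_[m'] <-> sqfree_power_exp P k.+1 (mres m') \/
    (0 < m' ord_max)%N /\ sqfree_power_exp P k (mres m').
  by rewrite squarefree_powerE mon_idealX sqfree_power_exp_adjoin.
have J1 : squarefree_power J k.+1 'X_[mext m1 1].
  by apply/JX; right; rewrite mext_max mres_mext.
have [[m2 /JX J2 <-] min2] := indegP J1.
apply/eqP; rewrite eqn_leq -e1; apply/andP; split.
  by have := min2 _ J1; rewrite (mdeg_mres (mext m1 1)) mres_mext mext_max addn1.
rewrite e1 mdeg_mres; case: J2 => [/(sqfree_power_exp_drop nP0)[m']|[m2_max]].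
  move=> /squarefree_powerX/min1 le_m' [_ lt_m'].
  exact: leq_trans (leq_ltn_trans le_m' lt_m') (leq_addr _ _).
by move=> /squarefree_powerX/min1 le_m2; rewrite -addn1; apply: leq_add.
Qed.

End AdjoinedPowers.

Theorem corollary2p5 (K : fieldType) (n : nat) (I : {mpoly K[n]} -> Prop)
  (hI : squarefree_monomial_ideal I)
  (hamb : smallest_ambient I)
  (hcl : forall k : nat, (1 <= k)%N -> (k <= monomial_grade I)%N ->
     componentwise_linear (squarefree_power I k))
  (hg : normalized_depth_nonincreasing I) :
  normalized_depth_nonincreasing (adjoin_variable I).
Proof.
have [P [upP nP0 radP eI]] := squarefree_monomial_idealE hI; subst I.
rewrite adjoin_variableE // => -[|k] l // _.
rewrite leq_eqVlt => /predU1P[<- //|]; case: l => [|l] // lt_kl le_l.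
have {}le_l := monomial_grade_adjoin nP0 le_l.
have ex_pow j : (j <= monomial_grade (@mon_ideal K n P))%N ->
    exists m, sqfree_power_exp P j m := monomial_grade_sqfree nP0 radP.
have le_k : (k.+1 <= monomial_grade (@mon_ideal K n P))%N by apply: leq_trans le_l.
have [mk mkP] := ex_pow _ le_k.
have [mk' mk'P] := ex_pow _ (ltnW le_k); have [ml mlP] := ex_pow _ le_l.
have g_kl := hg k.+1 l isT lt_kl le_l.
have lt_d := indeg_squarefree_powerS K nP0 mkP.
apply: (@le_trans _ _ (normalized_depth (@mon_ideal K n P) l)).
  rewrite /normalized_depth (indeg_adjoin K nP0 mlP).
  case: l lt_kl {le_l ml mlP g_kl} => // l _.
  by have := depth_adjoin_le K nP0 l; lia.
apply: (le_trans g_kl); rewrite /normalized_depth (indeg_adjoin K nP0 mk'P).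
set a := depth (squarefree_power _ k.+1); set d := indeg (squarefree_power _ k.+1).
set d' := indeg _ in lt_d *; set b := depth _.
(* this is g_I(k+1) <= g_J(k+1), with g_J(k+1) = b - d' *)
suff : (a - (d - d').-1 <= b)%N by rewrite -/d in lt_d; lia.
apply: depth_adjoin_ge => //; first by rewrite leq_subr.
case: k => [|k] in lt_kl le_k mk mkP mk' mk'P g_kl a d d' b lt_d *; [by left | right].
have := hg k.+1 k.+2 isT (leqnSn _) le_k; rewrite /normalized_depth -/a -/d -/d'.
by rewrite -/d in lt_d; lia.
Qed.
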